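(* Let $\Pi$ be a polar space of type $\mathsf{D}_n$, let $\delta\in\{+,-\}$, and let $m$ be an even integer satisfying $4\le m\le n$. Then for every isometric embedding $f$ of the $m$-dimensional half-cube graph $\frac12 H_m$ in the half-spin Grassmann graph $\Gamma_\delta(\Pi)$ there is an $(n-m-1)$-dimensional singular subspace $M$ of $\Pi$ such that the image of $f$ is an apartment of $\mathcal{G}_\delta(\Pi_M)=[M\rangle_\delta$. In particular, if $n$ is even, then the image of every isometric embedding of $\frac12 H_n$ in $\Gamma_\delta(\Pi)$ is an apartment of $\mathcal{G}_\delta(\Pi)$.
   Context: Partial linear spaces. A partial linear space is a pair $\Pi=(P,\mathcal{L})$, where $P$ is a non-empty set of points and $\mathcal{L}$ is a family of proper subsets of $P$ (lines), such that every line contains at least two points, every point lies on a line, and any two distinct collinear points $p,q$ lie on exactly one line $pq$ (points are collinear if some line contains all of them). A subspace is a subset $S\subset P$ containing the line $pq$ for all distinct collinear $p,q\in S$. A subspace is singular if any two of its distinct points are collinear (the empty set and single points are singular). $\langle X\rangle$ is the smallest subspace containing $X$. $X$ is independent if $\langle X\rangle$ is not spanned by a proper subset of $X$; a base of a subspace $S$ is an independent subset spanning $S$; $\dim S$ is the smallest cardinality $\alpha$ such that $S$ has a base of cardinality $\alpha+1$ (so $\dim\emptyset=-1$, points have dimension $0$, lines dimension $1$). Polar spaces. A polar space is a partial linear space $\Pi=(P,\mathcal L)$ such that: every line contains at least three points; no point is collinear to all points; if $p\in P$, $L\in\mathcal L$, then $p$ is collinear to one or all points of $L$; any flag of singular subspaces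 is finite. It has rank $n$ if its maximal singular subspaces have dimension $n-1$. It is of type $\mathsf{D}_n$ if it has rank $n$ and every $(n-2)$-dimensional singular subspace is contained in precisely two maximal singular subspaces. $p\perp q$ means that $p$ and $q$ are collinear. $\mathcal G_k(\Pi)$ is the set of $k$-dimensional singular subspaces. Dual polar and half-spin graphs. The dual polar graph $\Gamma_{n-1}(\Pi)$ has vertex set $\mathcal G_{n-1}(\Pi)$, two elements being adjacent if their intersection is $(n-2)$-dimensional; its distance is $d(S,U)=n-1-\dim(S\cap U)$. If $\Pi$ is of type $\mathsf D_n$, then $\mathcal G_{n-1}(\Pi)$ decomposes uniquely (up to naming) into two disjoint subsets $\mathcal G_+(\Pi)$, $\mathcal G_-(\Pi)$ (half-spin Grassmannians) such that $d$ is even within each of them and odd between them. The half-spin Grassmann graph $\Gamma_\delta(\Pi)$, $\delta\in\{+,-\}$, has vertex set $\mathcal G_\delta(\Pi)$, two elements being adjacent if their intersection is $(n-3)$-dimensional (i.e. $d=2$). Residues. Let $M$ be a $k$-dimensional singular subspace with $k<n-2$. $[M\rangle_{j}$ is the set of all $j$-dimensional singular subspaces containing $M$, and $[M\rangle_\delta$ is the set of all elements of $\mathcal G_\delta(\Pi)$ containing $M$. $\Pi_M$ denotes the polar space with point set $[M\rangle_{k+1}$ whose lines are the sets of all $X\in\mathcal G_{k+1}(\Pi)$ with $M\subset X\subset N$, for $N\in\mathcal G_{k+2}(\Pi)$ containing $M$. If $\Pi$ is of type $\mathsf D_n$, then $\Pi_M$ is of type $\mathsf D_{n-k-1}$; its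 maximal singular subspaces are the sets $[M,U]_{k+1}=\{X\in\mathcal G_{k+1}(\Pi): M\subset X\subset U\}$ with $U\in\mathcal G_{n-1}(\Pi)$ containing $M$, and identifying $[M,U]_{k+1}$ with $U$ one identifies its half-spin Grassmannian $\mathcal G_\delta(\Pi_M)$ with $[M\rangle_\delta$. If $M=\emptyset$ (dimension $-1$), then $\Pi_M=\Pi$. Frames and apartments. A frame of a polar space of rank $n$ is a set of $2n$ distinct points $p_1,\dots,p_{2n}$ such that for every $i$ there is a unique $\sigma(i)\in\{1,\dots,2n\}$ with $p_i\not\perp p_{\sigma(i)}$. The apartment of $\mathcal G_{n-1}(\Pi)$ associated to the frame is the set of all maximal singular subspaces spanned by subsets of the frame; the intersection of this set with $\mathcal G_\delta(\Pi)$ is the apartment of $\mathcal G_\delta(\Pi)$ associated to the frame (for $\Pi$ of type $\mathsf D_n$). Apartments of $\mathcal G_\delta(\Pi_M)$ are defined by frames of $\Pi_M$ and regarded as subsets of $[M\rangle_\delta$. Half-cube graph. $H_m$ is the graph on $\{0,1\}^m$ in which sequences differing in exactly one coordinate are adjacent. Its vertex set is the disjoint union of two sets with even distances within each and odd distances between them. $\frac12H_m$ is the graph whose vertex set is one of these two sets, with two vertices adjacent if their distance in $H_m$ is $2$ (the two choices give isomorphic graphs). Isometric embeddings. An embedding of a graph $\Gamma$ in a graph $\Gamma'$ is an injective map of vertex sets sending adjacent vertices to adjacent vertices and non-adjacent vertices to non-adjacent ones; it is isometric if it preserves the (path) distance. *)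

(* Defs.v *)
From mathcomp Require Import all_boot all_order all_algebra.
From mathcomp Require Import all_classical.

Set Implicit Arguments.
Unset Strict Implicit.
Unset Printing Implicit Defensive.

Local Open Scope classical_set_scope.
Local Open Scope card_scope.

(** * Partial linear spaces *)

(* The point set is a subset of an ambient type, so that a residue, whose
   points are subspaces, is again a [geometry] (over [set T]). *)
Record geometry (T : Type) := Geometry {
  points : set T;
  lines : set (set T) }.

Section Spaces.
Variables (T : Type) (Pi : geometry T).
Implicit Types (p q : T) (L S U X Y : set T) (k : int) (n : nat).

Record partial_linear_space : Prop := {
  pls_nonempty : points Pi !=set0;
  pls_proper : forall L, lines Pi L -> L `<` points Pi;
  pls_two : forall L, lines Pi L -> `I_2 #<= L;
  pls_cover : forall p, points Pi p -> exists2 L, lines Pi L & L p;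
  pls_unique : forall L L' p q, lines Pi L -> lines Pi L' -> p <> q ->
    L p -> L q -> L' p -> L' q -> L = L' }.

Definition collinear p q := exists L, [/\ lines Pi L, L p & L q].

Definition subspace S :=
  S `<=` points Pi /\
  forall L p q, lines Pi L -> S p -> S q -> p <> q -> L p -> L q -> L `<=` S.

Definition singular S :=
  subspace S /\ forall p q, S p -> S q -> p <> q -> collinear p q.

Definition subspace_span X := smallest subspace X.

Definition independent X :=
  forall Y, Y `<` X -> subspace_span Y <> subspace_span X.

Definition base_of S X := independent X /\ subspace_span X = S.

(* Only finite dimensions are captured, which is all that singular subspaces
   of polar spaces have; [k] is an integer so that the empty set has
   dimension -1. *)
Definition has_dim S k := exists X (a : nat),
  [/\ base_of S X, X #= `I_a, k = (a%:Z - 1)%R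
    & forall Y, base_of S Y -> X #<= Y].

Definition maximal_singular S :=
  singular S /\ forall U, singular U -> S `<=` U -> U = S.

(** * Polar spaces *)

Record polar_space : Prop := {
  polar_pls : partial_linear_space;
  polar_thick : forall L, lines Pi L -> `I_3 #<= L;
  polar_nondeg : forall p, points Pi p ->
    exists2 q, points Pi q & ~ collinear p q;
  polar_one_or_all : forall p L, points Pi p -> lines Pi L ->
    (exists! q, L q /\ collinear p q) \/ (forall q, L q -> collinear p q);
  polar_flags : forall C : set (set T), C `<=` singular ->
    (forall S U, C S -> C U -> S `<=` U \/ U `<=` S) -> finite_set C }.

Definition has_rank n :=
  forall S, maximal_singular S -> has_dim S (n%:Z - 1)%R.

(* $\mathcal G_k(\Pi)$ *)
Definition grassmannian k : set (set T) :=
  [set S | singular S /\ has_dim S k].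

Definition typeD n :=
  [/\ polar_space, has_rank n
    & forall A, grassmannian (n%:Z - 2)%R A ->
      [set U | maximal_singular U /\ A `<=` U] #= `I_2].

(** * Frames and apartments *)

Definition frame n (F : set T) := exists p : 'I_(2 * n) -> T,
  [/\ injective p, range p = F, F `<=` points Pi
    & forall i, exists! j, ~ collinear (p i) (p j)].

Definition apartment (F : set T) : set (set T) :=
  [set S | maximal_singular S /\ exists2 X, X `<=` F & S = subspace_span X].

(* [Gd] stands for a half-spin Grassmannian of [Pi], a space of rank [n]. *)
Definition is_half_apartment n (Gd A : set (set T)) :=
  exists2 F, frame n F & A = apartment F `&` Gd.

(** * Residues *)

(* $[M\rangle_{j}$ *)
Definition above (M : set T) (j : int) : set (set T) :=
  [set X | grassmannian j X /\ M `<=` X].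

(* $[M,U]_{j}$ *)
Definition residue_interval (M : set T) (j : int) (U : set T) : set (set T) :=
  [set X | above M j X /\ X `<=` U].

(* $\Pi_M$, for $M$ of dimension [k] *)
Definition residue (M : set T) k : geometry (set T) :=
  Geometry (above M (k + 1)%R)
           (residue_interval M (k + 1)%R @` above M (k + 2)%R).

(* $[M\rangle_\delta$ *)
Definition above_half (Gd : set (set T)) (M : set T) : set (set T) :=
  [set U | Gd U /\ M `<=` U].

End Spaces.

(* The half-spin Grassmannian of $\Pi_M$ consists of the maximal singular
   subspaces $[M,U]_{k+1}$ with [U] in [above_half Gd M]; its apartments are
   regarded as subsets of [above_half Gd M] by identifying $[M,U]_{k+1}$ with
   [U]. Here [k] is the dimension of [M] and [r] the rank of $\Pi_M$. *)
Definition is_residue_half_apartment (T : Type) (Pi : geometry T) (r : nat)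
    (Gd : set (set T)) (M : set T) (k : int) (A : set (set T)) :=
  let iv := residue_interval Pi M (k + 1)%R in
  exists2 B, is_half_apartment (residue Pi M k) r (iv @` above_half Gd M) B
    & A = [set U | above_half Gd M U /\ B (iv U)].

(** * Graphs *)

Record graph (V : Type) := Graph {
  vertices : set V;
  adjacent : V -> V -> Prop }.

Section Graphs.
Variables (V : Type) (G : graph V).

Definition walk (d : nat) (x y : V) := exists w : nat -> V,
  [/\ w 0 = x, w d = y,
      forall i, i <= d -> vertices G (w i)
    & forall i, i < d -> adjacent G (w i) (w i.+1)].

(* The path distance from [x] to [y] is (finite and equal to) [d]. *)
Definition dist (x y : V) (d : nat) :=
  walk d x y /\ forall e, walk e x y -> d <= e.

(* The vertex set is the disjoint union of [C true] and [C false], with even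
   distances within each of them and odd distances between them. *)
Definition parity_split (C : bool -> set V) :=
  [/\ C true `|` C false = vertices G, C true `&` C false = set0
    & forall b c x y, C b x -> C c y ->
        exists2 d, dist x y d & odd d = (b (+) c)].

End Graphs.

Definition graph_embedding (V W : Type) (G : graph V) (H : graph W)
    (f : V -> W) :=
  [/\ forall x, vertices G x -> vertices H (f x),
      forall x y, vertices G x -> vertices G y -> f x = f y -> x = y
    & forall x y, vertices G x -> vertices G y ->
        (adjacent G x y <-> adjacent H (f x) (f y))].

Definition isometric_embedding (V W : Type) (G : graph V) (H : graph W)
    (f : V -> W) :=
  graph_embedding G H f /\
  forall x y, vertices G x -> vertices G y ->
    forall d, dist G x y d <-> dist H (f x) (f y) d.

Definition dual_polar_graph (T : Type) (Pi : geometry T) (n : nat) :=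
  Graph (grassmannian Pi (n%:Z - 1)%R)
        (fun S U => has_dim Pi (S `&` U) (n%:Z - 2)%R).

Definition half_spin_graph (T : Type) (Pi : geometry T) (n : nat)
    (Gd : set (set T)) :=
  Graph Gd (fun S U => has_dim Pi (S `&` U) (n%:Z - 3)%R).

Definition hypercube (m : nat) : graph (m.-tuple bool) :=
  Graph setT (fun x y => #|[set i | tnth x i != tnth y i]%SET| = 1).

(* [C] is one of the two parts of a [parity_split] of the hypercube. *)
Definition half_cube (m : nat) (C : set (m.-tuple bool)) :=
  Graph C (fun x y => dist (hypercube m) x y 2).
Arguments half_cube m C : clear implicits.

(* Main.v *)
Require Import Defs.
From mathcomp Require Import all_boot all_order all_algebra.
From mathcomp Require Import all_classical.
From mathcomp Require Import zify.

Set Implicit Arguments.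
Unset Strict Implicit.
Unset Printing Implicit Defensive.

Local Open Scope classical_set_scope.
Local Open Scope card_scope.

(** The rank of a singular subspace is its dimension plus one. For maximal
    singular subspaces S and U, the number n - rank (S `&` U) is their distance
    in the dual polar graph, and half of it is their distance in a half-spin
    graph ([dual_polar_dist], [half_spin_dist]). Fix a vertex of the half-cube
    and name every other vertex by the even set of coordinates in which it
    differs from the fixed one: an isometric embedding becomes a family F of
    maximal singular subspaces, indexed by the even subsets of 'I_m, such that
    F I and F J meet in rank n - |I + J|, where I + J is the symmetric
    difference ([isometry_rank]).

    Since m is even, the antipode of the fixed vertex is a vertex too. Let S and
    U be the images of these two vertices and M = S `&` U, of rank n - m. By
    modularity F K contains F I `&` F J whenever K is between I and J. Hence M
    lies in every F I, and the traces W_I = F I `&` U have rank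
    rank M + |I|, increase with I, and satisfy W_I `&` W_J = M for disjoint I
    and J. In the projective space of U modulo M, of rank m, the pairs {i, j}
    thus index lines; the lines of disjoint pairs are skew, and those of two
    pairs with a common index meet in a point ([trace_adjacent]).

    If the lines of {i, j}, {i, l}, {i, a} were not concurrent, they would be
    coplanar. For m >= 6 this is absurd ([star6]): the third line would lie in
    W_{i,j,l,b}, so the line of {a, c}, which meets it, would meet W_{i,j,l,b}
    although the two index sets are disjoint. For m = 4 one failure of
    concurrency forces all of them, and then the lines of {i, j}, {i, l}, {j, l}
    are concurrent for all i, j, l. Exchanging the images of each pair and of its
    complement (an automorphism of the half-cube of dimension 4, the shadow of
    triality) turns this case into the other one and does not change the image
    of the embedding ([star_exists]).

    Once all lines with a common index i pass through one point P_i of U modulo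
    M, the P_i form a basis of this space, and the points Q_i of S modulo M that
    are perpendicular to all P_j with j <> i form the dual basis. F I contains
    P_i for i in I and Q_i for the other i. The P_i and Q_i are the frame of the
    residue of M that is looked for: counting ranks, an element of the
    half-spin Grassmannian that contains M and one of P_i, Q_i for each i is some
    F I ([cross_image]).

    Ranks and the modular law for singular subspaces come from one separation
    property ([rk_separates]): if x is perpendicular to the singular subspace A
    and not in A, some q is perpendicular to A but not to x. So a singular
    subspace A of C is cut out of C by perps of points, which gives the exchange
    property and, by counting these perps, the modular law. *)

(** * Perpendicularity and singular subspaces *)

Section Perp.
Variables (T : Type) (Pi : geometry T).
Hypothesis PiP : polar_space Pi.
Implicit Types (A B C D L S U X Y : set T) (p q x y z u w : T).

Local Notation pt := (points Pi).
Local Notation col := (collinear Pi).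

Lemma line_sub L : lines Pi L -> L `<=` pt.
Proof. by case/(pls_proper (polar_pls PiP)). Qed.

Lemma col_sym p q : col p q -> col q p.
Proof. by case=> L [? ? ?]; exists L. Qed.

Lemma col_ptl p q : col p q -> pt p.
Proof. by case=> L [/line_sub sub /sub ? _]. Qed.

Lemma col_ptr p q : col p q -> pt q.
Proof. by move/col_sym/col_ptl. Qed.

Lemma col_refl p : pt p -> col p p.
Proof. by case/(pls_cover (polar_pls PiP)) => L lL Lp; exists L. Qed.

Lemma col_line L p q : lines Pi L -> L p -> L q -> col p q.
Proof. by exists L. Qed.

Lemma line_nonempty L : lines Pi L -> L !=set0.
Proof.
move=> /(pls_two (polar_pls PiP)) L2.
apply/set0P/eqP => L0; move: L2; rewrite L0 card_le0 => /eqP I0.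
by have : `I_2 0 by []; rewrite I0.
Qed.

Lemma line_perp L x y z w : lines Pi L -> L x -> L y -> x <> y ->
  col w x -> col w y -> L z -> col w z.
Proof.
move=> lL Lx Ly xy wx wy Lz.
case: (polar_one_or_all PiP (col_ptl wx) lL) => [[t [_ tu]]|all]; last exact: all.
by case: xy; rewrite -(tu x) // -(tu y).
Qed.

Lemma line_meets_perp L w : pt w -> lines Pi L -> exists2 z, L z & col w z.
Proof.
move=> pw lL; case: (polar_one_or_all PiP pw lL) => [[t [[Lt wt] _]]|all].
  by exists t.
by have [z Lz] := line_nonempty lL; exists z => //; exact: all.
Qed.

Definition perpset X : set T := [set q | pt q /\ forall x, X x -> col x q].

Lemma perpset_subspace X : subspace Pi (perpset X).
Proof.
split=> [q [] //|L p q lL [pp Xp] [pq Xq] pNq Lp Lq z Lz].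
split; first exact: line_sub Lz.
by move=> x Xx; apply: (line_perp lL Lp Lq pNq) => //; [exact: Xp|exact: Xq].
Qed.

Lemma perpset_anti X Y : X `<=` Y -> perpset Y `<=` perpset X.
Proof. by move=> XY q [pq Yq]; split=> // x /XY /Yq. Qed.

Lemma perpset_sym X Y : X `<=` pt -> Y `<=` perpset X -> X `<=` perpset Y.
Proof.
by move=> Xpt YX x Xx; split; [exact: Xpt|move=> y /YX [_ /(_ x Xx) /col_sym]].
Qed.

Lemma perpset1 p q : perpset [set p] q <-> col p q.
Proof.
split=> [[_ ]|pq]; first exact.
by split; [exact: col_ptr pq|move=> x ->].
Qed.

Lemma points_subspace : subspace Pi pt.
Proof. by split=> // L p q lL *; exact: line_sub. Qed.

Lemma subset_span X : X `<=` subspace_span Pi X.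
Proof. exact: sub_gen_smallest. Qed.

Lemma span_min X S : subspace Pi S -> X `<=` S -> subspace_span Pi X `<=` S.
Proof. exact: smallest_sub. Qed.

Lemma span_subspace X : X `<=` pt -> subspace Pi (subspace_span Pi X).
Proof.
move=> Xpt; split; first by apply: span_min => //; exact: points_subspace.
move=> L p q lL Sp Sq pq Lp Lq z Lz S /= [sS XS].
case: (sS) => _ /(_ L p q lL); apply => //; [exact: Sp|exact: Sq].
Qed.

Lemma subspace_sub S : subspace Pi S -> S `<=` pt. Proof. by case. Qed.

Lemma span_id S : subspace Pi S -> subspace_span Pi S = S.
Proof. exact: smallest_id. Qed.

Lemma span_mono X Y : X `<=` Y -> subspace_span Pi X `<=` subspace_span Pi Y.
Proof. by move=> XY z Xz S /= [sS YS]; apply: Xz; split=> // x /XY/YS. Qed.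

Lemma perp_span X Y : Y `<=` perpset X -> subspace_span Pi Y `<=` perpset X.
Proof. by apply: span_min; exact: perpset_subspace. Qed.

Lemma subspaceI A B : subspace Pi A -> subspace Pi B -> subspace Pi (A `&` B).
Proof.
move=> [Apt sA] [_ sB]; split=> [x [/Apt]//|L p q lL [Ap Bp] [Aq Bq] pq Lp Lq z Lz].
by split; [exact: (sA L p q)|exact: (sB L p q)].
Qed.

(** Singularity as a set lying in its own perp: collinearity is reflexive on
    points, so the restriction to distinct points can be dropped. *)
Definition sing S := subspace Pi S /\ S `<=` perpset S.

Lemma singularE S : singular Pi S <-> sing S.
Proof.
split=> -[sS cS]; split=> //.
  move=> p Sp; have pp := subspace_sub sS Sp; split=> // q Sq.
  by have [->|/cS] := pselect (q = p); [exact: col_refl|exact].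
by move=> p q /cS[_ Sp] /Sp /col_sym.
Qed.

Lemma sing_sub S : sing S -> S `<=` pt. Proof. by case=> /subspace_sub. Qed.
Lemma sing_col S x y : sing S -> S x -> S y -> col x y.
Proof. by case=> _ cS Sx /cS [_ ]; exact. Qed.

Lemma sing_span X : X `<=` perpset X -> sing (subspace_span Pi X).
Proof.
move=> XX; have Xpt : X `<=` pt by move=> x /XX[].
split; first exact: span_subspace.
by apply: perp_span; apply: perpset_sym => //; exact: perp_span.
Qed.

Lemma sing0 : sing set0.
Proof. by split; [split|]. Qed.

Lemma singI A B : sing A -> subspace Pi B -> sing (A `&` B).
Proof.
move=> [sA cA] sB; split; first exact: subspaceI.
by move=> x [Ax _]; apply: perpset_anti (cA _ Ax) => y [].
Qed.

Lemma sing_subset A B : sing A -> subspace Pi B -> B `<=` A -> sing B.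
Proof. by move=> sA sB BA; rewrite -(setIidr BA); exact: singI. Qed.

Definition join A B := subspace_span Pi (A `|` B).

Lemma joinl A B : A `<=` join A B.
Proof. by move=> x Ax; apply: subset_span; left. Qed.
Lemma joinr A B : B `<=` join A B.
Proof. by move=> x Bx; apply: subset_span; right. Qed.
Lemma join_min A B S : subspace Pi S -> A `<=` S -> B `<=` S -> join A B `<=` S.
Proof. by move=> sS AS BS; apply: span_min => // x [/AS|/BS]. Qed.
Lemma sing_join A B : sing A -> sing B -> B `<=` perpset A -> sing (join A B).
Proof.
move=> sA sB AB; apply: sing_span => x ABx.
have BA : A `<=` perpset B by apply: perpset_sym => //; exact: sing_sub.
split; first by case: ABx => [/(sing_sub sA)|/(sing_sub sB)].
case: ABx => [Ax|Bx] y [Ay|By].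
- exact: sing_col sA _ _.
- by case: (BA x Ax) => _; exact.
- by case: (AB x Bx) => _; exact.
- exact: sing_col sB _ _.
Qed.

Lemma sing1 p : pt p -> sing [set p].
Proof.
move=> pp; split; last by move=> _ ->; apply/perpset1; exact: col_refl.
by split=> [_ ->//|L x y _ -> ->].
Qed.

(** * Separation, exchange and ranks *)

(** The core of the polar space axioms. Suppose that perpendicularity to z implied
    perpendicularity to x within Q. Take w in Q not perpendicular to x, the point
    u of L perpendicular to w, and r in Q not perpendicular to u. Then r is
    perpendicular to a point s of the line wu, and z to a point t of the line rs;
    by assumption t is perpendicular to all of L. The point a of L perpendicular
    to r is then perpendicular to r and t, hence to s, as is u: so s is
    perpendicular to x, and so is w. The set Q is meant to be everything or the
    perp of a singular subspace. *)
Lemma perp_separates Q L x z : subspace Pi Q -> lines Pi L -> x <> z -> L x -> L z ->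
    L `<=` Q -> (forall u, L u -> exists2 r, Q r & ~ col r u) ->
  exists q, [/\ Q q, col q z & ~ col q x].
Proof.
move=> [Qpt sQ] lL xz Lx Lz LQ LN; apply: contrapT => /forallNP H0.
have H q : Q q -> col q z -> col q x.
  by move=> Qq qz; apply: contrapT => qx; apply: (H0 q); split.
have [w Qw wx] := LN x Lx.
have [u Lu wu] := line_meets_perp (Qpt _ Qw) lL.
have [r Qr ru] := LN u Lu.
have xu : col x u by exact: col_line Lx Lu.
have wNu : w <> u by move=> wu'; apply: wx; rewrite wu'; exact: col_sym.
have [N [lN Nw Nu]] := wu.
have [s Ns rs] := line_meets_perp (Qpt _ Qr) lN.
have NQ : N `<=` Q by exact: (sQ N w u lN Qw (LQ _ Lu) wNu Nw Nu).
have su : s <> u by move=> su; apply: ru; rewrite -su.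
have sx : ~ col s x.
  move=> sx; apply: wx; apply/col_sym.
  by apply: (line_perp lN Ns Nu su) => //; exact: col_sym.
have sr : s <> r.
  by move=> sr; apply: ru; apply: (col_line lN _ Nu); rewrite -sr.
have [K [lK Kr Ks]] := rs.
have KQ : K `<=` Q by exact: (sQ K s r lK (NQ _ Ns) Qr sr Ks Kr).
have [t Kt zt] := line_meets_perp (line_sub lL Lz) lK.
have tz := col_sym zt; have tx := H t (KQ _ Kt) tz.
have rt : r <> t.
  by move=> rt; apply: ru; rewrite rt; exact: (line_perp lL Lx Lz xz).
have [a La ra] := line_meets_perp (Qpt _ Qr) lL.
have ta : col t a by exact: (line_perp lL Lx Lz xz).
have sa : col s a.
  by apply/col_sym; apply: (line_perp lK Kr Kt rt) => //; exact: col_sym.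
have au : a <> u by move=> au; apply: ru; rewrite -au.
by apply: sx; apply: (line_perp lL La Lu au) => //; exact: col_line Ns Nu.
Qed.

(** A rank is witnessed by a flag, growing by one point at a time, rather than by
    a base: hyperplane sections and exchange act on flags directly. *)
Inductive rk : set T -> nat -> Prop :=
| rk0 : rk set0 0
| rkS A p r : rk A r -> perpset A p -> ~ A p -> rk (join A [set p]) r.+1.

Lemma rk_sing A r : rk A r -> sing A.
Proof.
elim=> [|{}A p {}r _ sA Ap _]; first exact: sing0.
apply: sing_join => //; first by apply: sing1; case: Ap.
by move=> _ ->.
Qed.

Lemma perp_join A p q : col q p -> perpset A q -> perpset (join A [set p]) q.
Proof.
move=> qp Aq; have qpt := col_ptl qp.
have : join A [set p] `<=` perpset [set q].
  apply: join_min; first exact: perpset_subspace.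
    move=> a Aa; apply/perpset1; apply/col_sym; by case: Aq => _; exact.
  by move=> _ ->; apply/perpset1.
by move=> h; split=> // x /h/perpset1/col_sym.
Qed.

(** The induction adds a point z to A and applies the previous separation inside
    the perp of A to the line xz: none of its points is in A, since x would
    then be in the join of A and z, so each is separated from A by the
    induction hypothesis. *)
Lemma rk_separates A r x : rk A r -> perpset A x -> ~ A x ->
  exists2 q, perpset A q & ~ col q x.
Proof.
move=> rA; elim: rA x => [|{}A z {}r rA IH Az NAz] x Jx NJx.
  case: Jx => px _; have [q pq xq] := polar_nondeg PiP px.
  by exists q; [split|move/col_sym].
have AJ := @joinl A [set z]; have zJ := @joinr A [set z] z erefl.
have sJ : subspace Pi (join A [set z]) by have [] := rk_sing (rkS rA Az NAz).
have Ax : perpset A x by exact: perpset_anti Jx.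
have zx : col z x by case: Jx => _; exact.
have xz : x <> z by move=> xz; apply: NJx; rewrite xz.
have [L [lL Lz Lx]] := zx.
have LA : L `<=` perpset A.
  by case: (perpset_subspace A) => _ /(_ L x z); exact.
have LN u : L u -> exists2 r, perpset A r & ~ col r u.
  move=> Lu; apply: (IH u (LA _ Lu)) => Au.
  have uz : u <> z by move=> uz; apply: NAz; rewrite -uz.
  by apply: NJx; case: sJ => _ /(_ L u z lL (AJ _ Au) zJ uz Lu Lz); exact.
have [q [Aq qz qx]] := perp_separates (perpset_subspace A) lL xz Lx Lz LA LN.
by exists q => //; exact: perp_join.
Qed.

Lemma perpset_line X w q e L : lines Pi L -> perpset X w -> perpset X q -> w <> q ->
  L w -> L q -> L e -> perpset X e.
Proof.
move=> lL Xw Xq wq Lw Lq.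
by case: (perpset_subspace X) => _ /(_ L w q lL Xw Xq wq Lw Lq); exact.
Qed.

(** If p were outside the join of A and q, some w would be perpendicular to A and
    q but not to p; and some v is perpendicular to A but not to q. Once v and w
    are collinear, the line vw carries a point perpendicular to p, hence to q;
    q is also perpendicular to w, so to v. *)
Lemma rk_exchange A r p q : rk A r -> perpset A p -> join A [set p] q ->
  ~ A q -> join A [set q] p.
Proof.
move=> rA Ap Jq NAq; apply: contrapT => NJp.
have pp : pt p by case: Ap.
have Apt := sing_sub (rk_sing rA).
have Jperp w : perpset A w -> col w p -> col w q.
  by move=> Aw wp; have [_ h] := perp_join wp Aw; apply/col_sym/h.
have pq : col p q by apply: Jperp => //; exact: col_refl.
have Aq : perpset A q.
  have sA := rk_sing rA.
  have : join A [set p] `<=` perpset A.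
    apply: join_min; [exact: perpset_subspace| by case: sA |by move=> _ ->].
  exact.
have NAp : ~ A p by move=> NAp; apply: NJp; exact: joinl.
have rJ := rkS rA Aq NAq.
have [w0 Jw0 w0p] := rk_separates rJ (perp_join pq Ap) NJp.
have Aw0 := perpset_anti (@joinl A [set q]) Jw0.
have qw0 : col q w0 by case: Jw0 => _; apply; exact: joinr.
have [v Av vq] := rk_separates rA Aq NAq.
(* Sliding along the line of q and w0 makes the separating point collinear to v
   and keeps it off the perp of p. *)
have [w [Aw qw wp vw]] : exists w, [/\ perpset A w, col q w, ~ col w p & col v w].
  have [N [lN Nq Nw0]] := qw0.
  have w0q : w0 <> q by move=> e; apply: w0p; rewrite e; exact: col_sym.
  have [e Ne ve] := line_meets_perp (proj1 Av) lN.
  have eq : e <> q by move=> eq; apply: vq; rewrite -eq.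
  exists e; split=> //; first exact: (perpset_line lN Aw0 Aq).
    exact: (col_line lN Nq Ne).
  move=> ep; apply: w0p; apply/col_sym.
  by apply: (line_perp lN Ne Nq eq) => //; exact: col_sym.
have wv : w <> v by move=> wv; apply: vq; rewrite -wv; exact: col_sym.
have [N [lN Nv Nw]] := vw.
have [t Nt pt'] := line_meets_perp pp lN.
have At : perpset A t by exact: (perpset_line lN Aw Av).
have tw : t <> w by move=> tw; apply: wp; rewrite -tw; exact: col_sym.
apply: vq; apply/col_sym; apply: (line_perp lN Nt Nw tw) => //.
by apply/col_sym; apply: Jperp => //; exact: col_sym.
Qed.

(** B is the trace on its join with b of the perp of a separating point q, and
    every line meets a perp. *)
Lemma rk_hyperplane B r b L x y : rk B r -> perpset B b -> ~ B b ->
    lines Pi L -> L x -> L y -> x <> y -> join B [set b] x -> join B [set b] y ->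
  exists2 z, L z & B z.
Proof.
move=> rB Bb NBb lL Lx Ly xy Jx Jy.
have [q Bq qb] := rk_separates rB Bb NBb.
have [z Lz qz] := line_meets_perp (proj1 Bq) lL.
exists z => //; apply: contrapT => NBz.
have sJ : subspace Pi (join B [set b]) by have [] := rk_sing (rkS rB Bb NBb).
have Jz : join B [set b] z by case: sJ => _ /(_ L x y lL Jx Jy xy Lx Ly); exact.
have Jb := rk_exchange rB Bb Jz NBz.
by have [_ /(_ b Jb) /col_sym] := perp_join qz Bq.
Qed.

Lemma join_swap A r p q : rk A r -> perpset A p -> join A [set p] q ->
  ~ A q -> join A [set p] = join A [set q].
Proof.
move=> rA Ap Jq NAq; have sA := rk_sing rA.
have Apt := sing_sub sA; have pp : pt p by case: Ap.
have Jpt : join A [set p] `<=` pt.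
  by apply: join_min => //; [exact: points_subspace|move=> _ ->].
apply/seteqP; split; apply: join_min.
- by apply: span_subspace => x [/Apt//|->]; exact: Jpt.
- exact: joinl.
- by move=> _ ->; exact: rk_exchange rA Ap Jq NAq.
- by apply: span_subspace => x [/Apt//|->].
- exact: joinl.
- by move=> _ ->.
Qed.

(** The line from b to any other point of C meets B, in a point of C. *)
Lemma rk_cone B r b C : rk B r -> perpset B b -> ~ B b -> subspace Pi C ->
  C `<=` join B [set b] -> C b -> C = join (B `&` C) [set b].
Proof.
move=> rB Bb NBb sC CJ Cb; apply/seteqP; split; last first.
  by apply: join_min => // _ ->.
move=> x Cx; have [->|xb] := pselect (x = b); first exact: joinr.
have sJ := rk_sing (rkS rB Bb NBb).
have [L [lL Lx Lb]] := sing_col sJ (CJ _ Cx) (CJ _ Cb).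
have [z Lz Bz] := rk_hyperplane rB Bb NBb lL Lx Lb xb (CJ _ Cx) (CJ _ Cb).
have zb : z <> b by move=> zb; apply: NBb; rewrite -zb.
have Cz : C z by case: sC => _ /(_ L x b lL Cx Cb xb Lx Lb); exact.
have BCpt : B `&` C `|` [set b] `<=` pt.
  by have Cpt := subspace_sub sC; move=> y [[_ /Cpt]|->] //; exact: Cpt.
case: (span_subspace BCpt) => _ /(_ L z b lL); apply => //.
  by apply: joinl; split.
exact: joinr.
Qed.

Lemma perp_subset_or A q : A `<=` perpset [set q] \/ exists2 a, A a & ~ col q a.
Proof.
have [h|/existsNP[a /not_implyP[Aa h]]] := pselect (A `<=` perpset [set q]); first by left.
by right; exists a => // /perpset1.
Qed.

(** A section by a perp drops the rank by at most one. The flag of B is bent so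
    that its last point is in the perp as soon as its hyperplane is not. *)
Lemma rk_drop B s q : pt q -> rk B s -> B `<=` perpset [set q] \/
  exists2 s', s = s'.+1 & rk (B `&` perpset [set q]) s'.
Proof.
move=> pq rB0; elim: rB0 => {B s} [|B b s rB IH Bb NBb]; first by left.
set H := perpset [set q] in IH *.
have sH : subspace Pi H by exact: perpset_subspace.
have [JH|[j Jj qj]] := perp_subset_or (join B [set b]) q; first by left.
right; exists s => //.
have sJ := rk_sing (rkS rB Bb NBb); have [sB _] := rk_sing rB.
have joinH x : join B [set b] x -> ~ B x -> H x -> ~ B `<=` H.
  move=> Jx NBx Hx BH; apply: qj; apply/perpset1; apply: (_ : join B [set b] `<=` H) Jj.
  by rewrite (join_swap rB Bb Jx NBx); apply: join_min => // _ ->.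
have [BH|[a Ba qa]] := perp_subset_or B q.
  suff -> : join B [set b] `&` H = B by [].
  apply/seteqP; split=> [x [Jx Hx]|x Bx]; last by split; [exact: joinl|exact: BH].
  by apply: contrapT => NBx; exact: joinH Jx NBx Hx BH.
case: IH => [BH|[s' -> rBH]]; first by case: qa; apply/perpset1/BH.
have [c [Jc Hc NBc]] : exists c, [/\ join B [set b] c, H c & ~ B c].
  have [Hb|NHb] := pselect (H b); first by exists b; split=> //; exact: joinr.
  have ba : b <> a by move=> ba; apply: NBb; rewrite ba.
  have Jb : join B [set b] b by exact: joinr.
  have Ja : join B [set b] a by exact: joinl.
  have [L [lL Lb La]] := sing_col sJ Jb Ja.
  have [c Lc qc] := line_meets_perp pq lL.
  have Hc : H c by apply/perpset1.
  exists c; split=> //.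
    by case: sJ => -[_ /(_ L b a lL Jb Ja ba Lb La)] h _; exact: h.
  move=> Bc; apply: NBb; have ca : c <> a by move=> ca; apply: qa; rewrite -ca.
  by case: sB => _ /(_ L c a lL Bc Ba ca Lc La); exact.
have Bc : perpset B c.
  have : join B [set b] `<=` perpset B.
    by apply: join_min; [exact: perpset_subspace|case: (rk_sing rB)|move=> _ ->].
  exact.
rewrite (join_swap rB Bb Jc NBc) in sJ *.
have -> : join B [set c] `&` H = join (B `&` H) [set c].
  rewrite (rk_cone rB Bc NBc (C := join B [set c] `&` H)).
  - by rewrite setIA (setIidl (@joinl _ _)).
  - exact: subspaceI (proj1 sJ) _.
  - by move=> ? [].
  - by split=> //; exact: joinr.
apply: rkS => //; last by case.
by apply: perpset_anti Bc => ? [].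
Qed.

Lemma rk_subspace A r B : rk A r -> subspace Pi B -> B `<=` A -> exists2 s, rk B s & s <= r.
Proof.
move=> rA; elim: rA B => [|{}A p {}r rA IH Ap NAp] B sB BA.
  by exists 0 => //; move: BA; rewrite subset0 => ->; exact: rk0.
have [sA _] := rk_sing rA.
have [BsA|[b /not_implyP[Bb NAb]]] : B `<=` A \/ exists b, ~ (B b -> A b).
- by have [|/existsNP] := pselect (B `<=` A); [left|right].
- by have [s rB /leqW] := IH B sB BsA; exists s.
have Ab : perpset A b.
  have : join A [set p] `<=` perpset A.
    by apply: join_min; [exact: perpset_subspace|case: (rk_sing rA)|move=> _ ->].
  by apply; exact: BA.
have Jb := BA _ Bb; rewrite (join_swap rA Ap Jb NAb) in BA.
rewrite (rk_cone rA Ab NAb sB BA Bb).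
have [s rAB sr] := IH (A `&` B) (subspaceI sA sB) (@subIsetl _ _ _).
exists s.+1 => //; apply: rkS => //; last by case.
by apply: perpset_anti Ab => ? [].
Qed.

(** The last step of the flag of A is separated by some q, whose perp meets B
    within the hyperplane; [rk_drop] then charges at most one to B. *)
Lemma rk_le A r B s : rk A r -> rk B s -> B `<=` A -> s <= r.
Proof.
move=> rA; elim: rA B s => [|{}A p {}r rA IH Ap NAp] B s rB BA.
  case: rB BA => // {}B b {}s rB Bb _ /(_ b) h.
  by case: h; exact: joinr.
have [q Aq qp] := rk_separates rA Ap NAp.
have [sB _] := rk_sing rB.
have BHA : B `&` perpset [set q] `<=` A.
  move=> x [Bx /perpset1 qx]; apply: contrapT => NAx; apply: qp.
  have := rk_exchange rA Ap (BA _ Bx) NAx.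
  by case: (perp_join qx Aq) => _ /[apply] /col_sym.
have [BH|[s' -> rBH]] := rk_drop (proj1 Aq) rB.
  by apply/leqW/(IH B) => // x Bx; apply: BHA; split=> //; exact: BH.
exact: IH rBH BHA.
Qed.

Lemma rk_uniq A r s : rk A r -> rk A s -> r = s.
Proof. by move=> rA sA; apply/eqP; rewrite eqn_leq (rk_le rA sA) // (rk_le sA rA). Qed.

Lemma rk_eq A B r : rk A r -> rk B r -> B `<=` A -> B = A.
Proof.
move=> rA rB BA; apply/seteqP; split=> // x Ax; apply: contrapT => NBx.
have Bx : perpset B x.
  by apply: (perpset_anti BA); case: (rk_sing rA) => _; exact.
have : join B [set x] `<=` A.
  by apply: join_min => //; [case: (rk_sing rA)|move=> _ ->].
by move/(rk_le rA (rkS rB Bx NBx)); rewrite ltnn.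
Qed.

End Perp.

(** * Rank and dimension *)

Lemma setU1D1 (T : Type) (X : set T) (x : T) : ~ X x -> (x |` X) `\ x = X.
Proof.
move=> Nx; apply/seteqP; split=> [y [[->|//] /(_ erefl)] //|y Xy].
by split; [right|move=> yx; apply: Nx; rewrite -yx].
Qed.

Lemma card_setD1 (T : Type) (X : set T) (x : T) r : X #= `I_r -> X x ->
  exists2 s, r = s.+1 & X `\ x #= `I_s.
Proof.
move=> Xr Xx.
have fX : finite_set (X `\ x).
  by apply: sub_finite_set (_ : finite_set X) => [y []//|]; apply/finite_setP; exists r.
have /finite_setP[s Xs] := fX; exists s => //; apply/card_eq_II.
by apply: card_eq_trans (card_esym Xr) _; apply/eq_cardSP; exists x.
Qed.

Lemma infinite_sub (T : Type) (X : set T) k : ~ finite_set X ->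
  exists2 Z, Z `<=` X & Z #= `I_k.
Proof.
move=> infX; elim: k => [|k [Z ZX Zk]].
  by exists set0 => //; rewrite II0 card_eq00.
have [x /not_implyP[Xx NZx]] : exists x, ~ (X x -> Z x).
  apply/existsNP => XZ; apply: infX; apply: sub_finite_set XZ _.
  by apply/finite_setP; exists k.
exists (x |` Z); first by move=> y [->|/ZX].
apply/eq_cardSP; exists x; first by left.
by rewrite setU1D1.
Qed.

Section Bases.
Variables (T : Type) (Pi : geometry T).
Hypothesis PiP : polar_space Pi.
Implicit Types (A B C D L S U X Y Z : set T) (p q x y z u w : T) (r s k : nat).

Lemma span_setD1 Z x : Z x -> subspace_span Pi Z =
  subspace_span Pi (subspace_span Pi (Z `\ x) `|` [set x]).
Proof.
move=> Zx; apply/seteqP; split=> y Zy S [sS sub]; apply: Zy; split=> //.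
  move=> z Zz; have [->|zx] := pselect (z = x); first by apply: sub; right.
  by apply: sub; left; apply: subset_span; split.
move=> z [|->]; last exact: sub.
by apply: span_min => // t [/sub].
Qed.

Lemma rk_span_le Z k : Z `<=` perpset Pi Z -> Z #= `I_k ->
  exists2 r, rk Pi (subspace_span Pi Z) r & r <= k.
Proof.
elim: k Z => [|k IH] Z cZ.
  rewrite II0 card_eq0 => /eqP ->; exists 0 => //.
  by rewrite span_id; [exact: rk0|case: (sing0 Pi)].
move=> /eq_cardSP[x Zx Zk].
have [y [Zy _]|r rZ rk] := IH _ _ Zk.
  by apply: perpset_anti (cZ _ Zy) => ? [].
have [xZ|xZ] := pselect (subspace_span Pi (Z `\ x) x).
  exists r; last exact: leqW.
  suff -> : subspace_span Pi Z = subspace_span Pi (Z `\ x) by [].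
  rewrite (span_setD1 Zx) setUidl; last by move=> _ ->.
  by rewrite span_id //; case: (rk_sing PiP rZ).
exists r.+1 => //; rewrite (span_setD1 Zx); apply: rkS => //.
suff /(_ x Zx) : Z `<=` perpset Pi (subspace_span Pi (Z `\ x)) by [].
apply: perpset_sym => //; first by move=> ? /cZ [].
apply: perp_span => // y [Zy _]; exact: cZ.
Qed.

Lemma rk_independent X Z k : X `<=` perpset Pi X -> independent Pi X -> Z `<=` X ->
  Z #= `I_k -> rk Pi (subspace_span Pi Z) k.
Proof.
move=> cX iX; elim: k Z => [|k IH] Z ZX.
  rewrite II0 card_eq0 => /eqP ->.
  by rewrite span_id; [exact: rk0|case: (sing0 Pi)].
move=> /eq_cardSP[x Zx Zk]; have Xx := ZX _ Zx.
have rZ : rk Pi (subspace_span Pi (Z `\ x)) k by apply: IH => // y [/ZX].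
rewrite (span_setD1 Zx); apply: rkS => //.
  suff /(_ x Xx) : X `<=` perpset Pi (subspace_span Pi (Z `\ x)) by [].
  apply: perpset_sym => //; first by move=> ? /cX [].
  by apply: perp_span => // y [/ZX Xy _]; exact: cX.
move=> xZ; apply: (iX (X `\ x)).
  by split=> [? []//|/(_ x Xx) [_]]; exact.
have xX : subspace_span Pi (X `\ x) x.
  by apply: span_mono xZ => y [/ZX].
rewrite (span_setD1 Xx) setUidl; last by move=> _ ->.
rewrite [RHS]span_id //; apply: span_subspace => // y [/cX[]//].
Qed.

(** Finite subsets of an independent set have full rank, which bounds their size by
    the rank of S; so an independent set of any cardinality is finite. *)
Lemma base_card S X r : rk Pi S r -> base_of Pi S X -> X #= `I_r.
Proof.
move=> rS [iX XS].
have XsS : X `<=` S by rewrite -XS; exact: subset_span.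
have cX : X `<=` perpset Pi X.
  by move=> x /XsS Sx; apply: (perpset_anti XsS); case: (rk_sing PiP rS) => _; exact.
have [/finite_setP[k Xk]|infX] := pselect (finite_set X).
  have := rk_independent cX iX (@subset_refl _ _) Xk.
  by rewrite XS => /(rk_uniq PiP rS) ->.
have [Z ZX Zr] := infinite_sub r.+1 infX.
have rZ := rk_independent cX iX ZX Zr.
have : subspace_span Pi Z `<=` S by rewrite -XS; exact: span_mono.
by move/(rk_le PiP rS rZ); rewrite ltnn.
Qed.

Lemma rk_base S r : rk Pi S r -> exists X, base_of Pi S X /\ X #= `I_r.
Proof.
move=> rS; have [X [XS Xr]] : exists X, subspace_span Pi X = S /\ X #= `I_r.
  elim: rS => [|A p {}r rA [X [XA Xr]] Ap NAp].
    by exists set0; rewrite II0 card_eq00 span_id //; case: (sing0 Pi).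
  have XsA : X `<=` A by rewrite -XA; exact: subset_span.
  have NXp : ~ X p by move/XsA.
  exists (p |` X); split; last by apply/eq_cardSP; exists p; [left|rewrite setU1D1].
  by rewrite (@span_setD1 _ p); [rewrite setU1D1 // XA|left].
exists X; split=> //; split=> // Y [YX /existsNP[x /not_implyP[Xx NYx]]] YS.
have [s rs Xs] := card_setD1 Xr Xx.
have XsS : X `<=` S by rewrite -XS; exact: subset_span.
have [t rt ts] : exists2 t, rk Pi (subspace_span Pi (X `\ x)) t & t <= s.
  apply: rk_span_le => // y [/XsS Sy _].
  apply: perpset_anti (_ : perpset Pi S y); first by move=> z [/XsS].
  by case: (rk_sing PiP rS) => _; exact.
have E : subspace_span Pi (X `\ x) = S.
  apply/seteqP; split; first by rewrite -XS; apply: span_mono => ? [].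
  by rewrite -XS -YS; apply: span_mono => y Yy; split; [exact: YX|move=> yx; rewrite yx in Yy].
by have := rk_uniq PiP rS; rewrite -E => /(_ _ rt) rE; move: ts; rewrite -rE rs ltnn.
Qed.

Lemma rk_has_dim S r (k : int) : rk Pi S r -> has_dim Pi S k <-> k = (r%:Z - 1)%R.
Proof.
move=> rS; split=> [[X [a [bX Xa -> _]]]|->].
  by have /card_eq_II <- : `I_r #= `I_a by exact: card_eq_trans (card_esym (base_card rS bX)) Xa.
have [X [bX Xr]] := rk_base rS; exists X, r; split=> // Y /(base_card rS) Yr.
by have /card_eqPle[] : X #= Y by exact: card_eq_trans Xr (card_esym Yr).
Qed.

Variable n : nat.
Hypothesis Pin : has_rank Pi n.

Lemma maximal_rk S : maximal_singular Pi S -> rk Pi S n.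
Proof.
move=> mS; case: (mS) => /(singularE PiP) sS _.
have [X [a [bX Xa na _]]] := Pin mS.
have an : n = a by lia.
have [_ XS] := bX; have XsS : X `<=` S by rewrite -XS; exact: subset_span.
have [r] : exists2 r, rk Pi (subspace_span Pi X) r & r <= a.
  apply: rk_span_le => // y /XsS Sy.
  by apply: (perpset_anti XsS); case: sS => _; exact.
rewrite XS an => rS _.
by have /card_eq_II <- : `I_r #= `I_a by exact: card_eq_trans (card_esym (base_card rS bX)) Xa.
Qed.

(** Zorn's lemma is applied to the sets whose union with A is singular, so that
    the empty chain needs no separate treatment. *)
Lemma maximal_above A : singular Pi A -> exists2 S, maximal_singular Pi S & A `<=` S.
Proof.
move=> sA; pose P B := singular Pi (A `|` B).
have [|S [PS maxS]] := @Zorn_bigcup T P.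
  move=> F FP totF.
  have FF x y : (A `|` \bigcup_(X in F) X) x -> (A `|` \bigcup_(X in F) X) y ->
     exists2 C, singular Pi C & [/\ C x, C y & C `<=` (A `|` \bigcup_(X in F) X)].
    have sub B : F B -> A `|` B `<=` (A `|` \bigcup_(X in F) X).
      by move=> FB z [Az|Bz]; [left|right; exists B].
    move=> [Ax|[B FB Bx]] [Ay|[C FC Cy]].
    - by exists A => //; split=> // z Az; left.
    - by exists (A `|` C); [exact: FP|split; [left|right|exact: sub]].
    - by exists (A `|` B); [exact: FP|split; [right|left|exact: sub]].
    - have [BC|CB] := totF _ _ FB FC.
        by exists (A `|` C); [exact: FP|split; [right; exact: BC|right|exact: sub]].
      by exists (A `|` B); [exact: FP|split; [right|right; exact: CB|exact: sub]].
  split; last first.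
    by move=> p q Up Uq pq; have [C [_ cC] [Cp Cq _]] := FF p q Up Uq; exact: cC.
  split; first by move=> x Ux; have [C [[Cpt _] _] [/Cpt]] := FF x x Ux Ux.
  move=> L p q lL Up Uq pq Lp Lq z Lz; have [C [[_ sC] _] [Cp Cq CU]] := FF p q Up Uq.
  by apply: CU; exact: (sC L p q).
have AS : A `<=` S.
  apply: contrapT => NAS; apply: (maxS (A `|` S)).
    by split=> [z Sz|AS]; [right|apply: NAS => z Az; apply: AS; left].
  by rewrite /P setUA setUid.
rewrite /P (setUidr AS) in PS.
exists S => //; split=> // U sU SU; apply/seteqP; split=> //.
apply: contrapT => NUS; apply: (maxS U); first by split.
by rewrite /P setUidr // => z /AS/SU.
Qed.

(** The default value 0 is never met on singular subspaces ([sing_rk]). *)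
Definition rank A : nat := xget 0 [set r | rk Pi A r].

Lemma sing_rk A : sing Pi A -> rk Pi A (rank A).
Proof.
move=> sA; have /(singularE PiP)/maximal_above [S /maximal_rk rS AS] := sA.
have [r rA _] := rk_subspace PiP rS (proj1 sA) AS.
exact: (@xgetPex _ 0 [set r | rk Pi A r]) (ex_intro _ r rA).
Qed.

Lemma rk_rank A r : rk Pi A r -> rank A = r.
Proof. by move=> rA; exact: (rk_uniq PiP (sing_rk (rk_sing PiP rA)) rA). Qed.

Lemma rank_le_n A : sing Pi A -> rank A <= n.
Proof.
move=> sA; have /(singularE PiP)/maximal_above [S /maximal_rk rS AS] := sA.
exact: (rk_le PiP rS (sing_rk sA) AS).
Qed.

Lemma has_dimP A (k : int) : sing Pi A -> has_dim Pi A k <-> k = ((rank A)%:Z - 1)%R.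
Proof. by move/sing_rk/rk_has_dim. Qed.

Lemma grassmannianP A (k : int) : grassmannian Pi k A <-> sing Pi A /\ k = ((rank A)%:Z - 1)%R.
Proof.
split=> [[/(singularE PiP) sA /(has_dimP _ sA)]//|[sA kA]].
by split; [exact/(singularE PiP)|exact/has_dimP].
Qed.

Lemma rank_mono A B : sing Pi B -> sing Pi A -> A `<=` B -> rank A <= rank B.
Proof. by move=> sB sA; exact: (rk_le PiP (sing_rk sB) (sing_rk sA)). Qed.

Lemma rank_eq A B : sing Pi B -> sing Pi A -> A `<=` B -> rank B <= rank A -> A = B.
Proof.
move=> sB sA AB BA; have AEB : rank A = rank B by apply/eqP; rewrite eqn_leq rank_mono.
by apply: (rk_eq PiP (sing_rk sB)) => //; rewrite -AEB; exact: sing_rk.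
Qed.

Lemma rank0 : rank set0 = 0. Proof. exact: rk_rank (rk0 Pi). Qed.

Lemma rank_add A p : sing Pi A -> perpset Pi A p -> ~ A p ->
  rank (join Pi A [set p]) = (rank A).+1.
Proof. by move=> sA Ap NAp; apply: rk_rank; exact: rkS (sing_rk sA) Ap NAp. Qed.

Lemma sing_add A p : sing Pi A -> perpset Pi A p -> sing Pi (join Pi A [set p]).
Proof.
by move=> sA Ap; apply: sing_join => //; [apply: sing1 => //; case: Ap|move=> _ ->].
Qed.

Lemma rank1 p : points Pi p -> rank [set p] = 1.
Proof.
move=> pp; have [s1 _] := sing1 PiP pp.
have := rank_add (sing0 Pi) (p := p); rewrite rank0 /join set0U span_id //.
by apply=> //; split.
Qed.

Lemma rank_eq1 A : sing Pi A -> rank A = 1 -> exists p, A = [set p].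
Proof.
move=> sA A1; have [A0|/eqP/set0P[p Ap]] := pselect (A = set0).
  by rewrite A0 rank0 in A1.
have pp := sing_sub sA Ap.
exists p; apply/esym/rank_eq => //; first exact: sing1.
- by move=> _ ->.
- by rewrite A1 rank1.
Qed.

Lemma rank_add_le A p : sing Pi A -> perpset Pi A p ->
  rank (join Pi A [set p]) <= (rank A).+1.
Proof.
move=> sA Ap; have [Ap'|NAp] := pselect (A p); last by rewrite rank_add.
rewrite /join setUidl; last by move=> _ ->.
by rewrite span_id //; case: sA.
Qed.

Lemma rank_drop A q : sing Pi A -> points Pi q -> rank A <= (rank (A `&` perpset Pi [set q])).+1.
Proof.
move=> sA pq; have [Aq|[s sE rs]] := rk_drop PiP pq (sing_rk sA).
  by rewrite (setIidl Aq).
by rewrite (rk_rank rs) sE.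
Qed.

(** Climbing from A to B by adding points of B; the difference of ranks decreases. *)
Lemma sing_ind (P : set T -> Prop) A B : sing Pi A -> sing Pi B -> A `<=` B ->
  P A -> (forall D p, sing Pi D -> A `<=` D -> D `<=` B -> B p -> ~ D p ->
     perpset Pi D p -> P D -> P (join Pi D [set p])) -> P B.
Proof.
move=> sA sB AB PA step.
suff H k D : sing Pi D -> A `<=` D -> D `<=` B -> P D -> rank B - rank D <= k -> P B.
  exact: (H _ A).
elim: k D => [|k IH] D sD AD DB PD kD.
  have BD : rank B <= rank D by lia.
  by rewrite -(rank_eq sB sD DB BD).
have [BD|/existsNP[p /not_implyP[Bp NDp]]] := pselect (B `<=` D).
  by have -> : B = D by apply/seteqP.
have Dp : perpset Pi D p by apply: (perpset_anti DB); case: sB => _; exact.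
apply: (IH (join Pi D [set p])).
- exact: sing_add.
- by move=> x /AD; exact: joinl.
- by apply: join_min => //; [case: sB|move=> _ ->].
- exact: step.
- by rewrite rank_add //; lia.
Qed.

Lemma sing_separates A x : sing Pi A -> perpset Pi A x -> ~ A x ->
  exists2 q, perpset Pi A q & ~ collinear Pi q x.
Proof. by move=> sA Ax NAx; exact: (rk_separates PiP (sing_rk sA)). Qed.

(** The perp of B is the perp of A `&` B, which contains A, cut by one perp for each
    further point of a flag of B. *)
Lemma rank_meet_perp A B : sing Pi A -> sing Pi B ->
  rank A + rank (A `&` B) <= rank (A `&` perpset Pi B) + rank B.
Proof.
move=> sA sB.
have sAB : sing Pi (A `&` B) by apply: singI => //; case: sB.
pose P D := rank A + rank (A `&` B) <= rank (A `&` perpset Pi D) + rank D.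
apply: (@sing_ind P (A `&` B) B) => //.
  rewrite /P (_ : A `&` perpset Pi (A `&` B) = A) // setIidl //.
  by move=> x Ax; apply: (perpset_anti (@subIsetl _ A B)); case: sA => _; exact.
move=> D p sD _ DB Bp NDp Dp; rewrite /P rank_add // => IH.
have pp : points Pi p by case: Dp.
have : A `&` perpset Pi D `&` perpset Pi [set p] `<=` A `&` perpset Pi (join Pi D [set p]).
  by move=> x [[Ax Dx] /(perpset1 PiP) px]; split=> //; apply: perp_join => //; exact: col_sym.
have sADp (Q : set T) : sing Pi (A `&` perpset Pi Q) by apply: singI => //; exact: perpset_subspace.
move/rank_mono => /(_ (sADp _)) h.
have := rank_drop (sADp D) pp.
have := h (singI (sADp D) (perpset_subspace PiP _)).
lia.
Qed.

(** The modular law. The upper bound on the join is submodularity. For the lower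
    bound, B is cut out of the join by as many perps as its corank, and each
    of them costs A at most one. *)
Lemma rank_joinI A B : sing Pi A -> sing Pi B -> B `<=` perpset Pi A ->
  rank (join Pi A B) + rank (A `&` B) = rank A + rank B.
Proof.
move=> sA sB BA; have sJ := sing_join PiP sA sB BA.
have sAB : sing Pi (A `&` B) by apply: singI => //; case: sB.
apply/eqP; rewrite eqn_leq; apply/andP; split.
  pose P D := rank (join Pi A D) + rank (A `&` B) <= rank A + rank D.
  apply: (@sing_ind P (A `&` B) B) => //.
    by rewrite /P /join setUidl // span_id //; case: sA.
  move=> D p sD _ DB Bp NDp Dp; rewrite /P rank_add // => IH.
  have sAD : sing Pi (join Pi A D).
    by apply: sing_join => // x /DB/BA.
  have ADp : perpset Pi (join Pi A D) p.
    have ADB : join Pi A D `<=` perpset Pi [set p].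
      apply: join_min => [|x Ax|x Dx]; first exact: perpset_subspace.
        by apply/(perpset1 PiP)/col_sym; case: (BA _ Bp) => _ /(_ x Ax).
      by apply/(perpset1 PiP)/col_sym; case: Dp => _; exact.
    split; first by case: Dp.
    by move=> x ADx; apply: col_sym; apply/(perpset1 PiP); exact: ADB.
  suff : join Pi A (join Pi D [set p]) `<=` join Pi (join Pi A D) [set p].
    move/rank_mono => /(_ (sing_add sAD ADp)) h.
    have := rank_add_le sAD ADp.
    suff : rank (join Pi A (join Pi D [set p])) <= rank (join Pi (join Pi A D) [set p]) by lia.
    apply: h; apply: sing_join => //; first exact: sing_add.
    apply: join_min; [exact: perpset_subspace|by move=> x /DB/BA|by move=> _ ->; exact: BA].
  have sJp : subspace Pi (join Pi (join Pi A D) [set p]) by case: (sing_add sAD ADp).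
  apply: join_min => //; first by move=> x Ax; do 2 apply: joinl.
  apply: join_min => //; last exact: joinr.
  by move=> x Dx; apply: joinl; exact: joinr.
set C := join Pi A B.
pose P D := rank A + rank D <= rank C + rank (A `&` D).
suff : P B by rewrite /P /C; lia.
suff H k D : sing Pi D -> D `<=` C -> rank C - rank D <= k -> P D.
  by apply: (H _ B) => //; exact: joinr.
elim: k D => [|k IH] D sD DC kD.
  have E : D = C by apply: rank_eq => //; lia.
  by rewrite /P E setIidl; [lia|exact: joinl].
have [CD|/existsNP[p /not_implyP[Cp NDp]]] := pselect (C `<=` D).
  have -> : D = C by apply/seteqP.
  by rewrite /P setIidl; [lia|exact: joinl].
have Dp : perpset Pi D p by apply: (perpset_anti DC); case: sJ => _; exact.
have DpC : join Pi D [set p] `<=` C by apply: join_min => //; [case: sJ|move=> _ ->].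
have {IH} := IH (join Pi D [set p]) (sing_add sD Dp) DpC.
rewrite /P rank_add // => IH.
have [q Dq qp] := sing_separates sD Dp NDp.
have sADp E : subspace Pi E -> sing Pi (A `&` E) by exact: singI.
have h : A `&` join Pi D [set p] `&` perpset Pi [set q] `<=` A `&` D.
  move=> x [[Ax Jx] /(perpset1 PiP) qx]; split=> //; apply: contrapT => NDx; apply: qp.
  have [_ h2] := perp_join PiP qx Dq.
  exact: (col_sym (h2 _ (rk_exchange PiP (sing_rk sD) Dp Jx NDx))).
have sJD : subspace Pi (join Pi D [set p]) by case: (sing_add sD Dp).
have := rank_mono (sADp _ (proj1 sD)) (singI (sADp _ sJD) (perpset_subspace PiP _)) h.
have := rank_drop (sADp _ sJD) (proj1 Dq).
by have := IH _; lia.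
Qed.

End Bases.

(** * Distances between maximal singular subspaces *)

(** A function is the path distance as soon as it is 1-Lipschitz along edges and
    every nonzero value can be lowered by one along some edge. *)
Lemma dist_formula (V : Type) (G : graph V) (c : V -> V -> nat) :
    (forall x, vertices G x -> c x x = 0) ->
    (forall x z, vertices G x -> vertices G z -> c x z = 0 -> x = z) ->
    (forall x y z, vertices G x -> vertices G y -> vertices G z ->
       adjacent G x y -> c x z <= (c y z).+1) ->
    (forall x z k, vertices G x -> vertices G z -> c x z = k.+1 ->
       exists y, [/\ vertices G y, adjacent G x y & c y z = k]) ->
  forall x z d, vertices G x -> vertices G z -> dist G x z d <-> c x z = d.
Proof.
move=> c0 c0P cstep cex.
have low d x z : vertices G z -> walk G d x z -> c x z <= d.
  move=> Gz; elim: d x => [|d IH] x [w [w0 wd wG wa]].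
    have xz : x = z by rewrite -w0 -wd.
    by rewrite xz c0.
  have Gx : vertices G x by rewrite -w0; exact: wG.
  have Gy : vertices G (w 1) by exact: wG.
  have cy : c (w 1) z <= d.
    apply: IH; exists (fun i => w i.+1); split=> // i id; [exact: wG|exact: wa].
  have := cstep x (w 1) z Gx Gy Gz; rewrite -w0 => /(_ (wa 0 isT)).
  lia.
have ex d x z : vertices G x -> vertices G z -> c x z = d -> walk G d x z.
  move=> Gx Gz; elim: d x Gx => [|d IH] x Gx.
    by move/(c0P _ _ Gx Gz) => <-; exists (fun=> x).
  move=> /(cex _ _ _ Gx Gz)[y [Gy xy /(IH _ Gy)[w [w0 wd wG wa]]]].
  exists (fun i => if i is j.+1 then w j else x); split=> //.
    by move=> [|i] // id; exact: wG.
  by move=> [|i] // id; [rewrite w0|exact: wa].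
move=> x z d Gx Gz; have wc := ex _ _ _ Gx Gz erefl; split=> [[wd min]|<-].
  by apply/eqP; rewrite eqn_leq (low _ _ _ Gz wd) min.
by split=> // e /(low _ _ _ Gz).
Qed.

Section MaximalSingular.
Variables (T : Type) (Pi : geometry T).
Hypothesis PiP : polar_space Pi.
Variable n : nat.
Hypothesis Pin : has_rank Pi n.
Implicit Types (A B C D L S U X Y Z : set T) (p q x y z u w : T) (r s k : nat).

Local Notation rank := (rank Pi).
Local Notation sing := (sing Pi).
Local Notation perpset := (perpset Pi).

(** The maximal singular subspaces, described by their rank ([generator_maximal]). *)
Definition generator S := sing S /\ rank S = n.

Lemma generator_sing S : generator S -> sing S. Proof. by case. Qed.

Lemma generatorE S : grassmannian Pi (n%:Z - 1)%R S <-> generator S.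
Proof.
split=> [/(grassmannianP PiP Pin)[sS E]|[sS E]]; first by split=> //; lia.
by apply/(grassmannianP PiP Pin); rewrite E.
Qed.

Lemma generator_maximal S : maximal_singular Pi S <-> generator S.
Proof.
split=> [mS|[sS E]].
  have rS := maximal_rk PiP Pin mS.
  by split; [exact: (rk_sing PiP rS)|exact: (rk_rank PiP Pin)].
split; first exact/(singularE PiP).
move=> U /(singularE PiP) sU SU; apply/esym/(rank_eq PiP Pin) => //.
by rewrite E; exact: rank_le_n.
Qed.

Lemma generator_perp S x : generator S -> perpset S x -> S x.
Proof.
move=> [sS Sn] Sx; apply: contrapT => NSx.
have := rank_le_n PiP Pin (sing_add PiP sS Sx).
by rewrite (rank_add PiP Pin) // Sn ltnn.
Qed.

Lemma singII A B : sing A -> sing B -> sing (A `&` B).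
Proof. by move=> sA [sB _]; exact: singI. Qed.

Lemma rank_sub A B : sing A -> sing B -> A `<=` B -> rank A <= rank B.
Proof. by move=> sA sB; exact: (rank_mono PiP Pin). Qed.

Lemma sub_perp A B C : sing C -> A `<=` C -> B `<=` C -> A `<=` perpset B.
Proof.
move=> [_ cC] AC BC x /AC/cC; exact: perpset_anti.
Qed.

Lemma rank_join_in A B C : sing A -> sing B -> sing C -> A `<=` C -> B `<=` C ->
  [/\ sing (join Pi A B), join Pi A B `<=` C &
      rank (join Pi A B) + rank (A `&` B) = rank A + rank B].
Proof.
move=> sA sB sC AC BC.
have BA : B `<=` perpset A by exact: sub_perp BC AC.
split; first exact: sing_join.
- by apply: join_min => //; case: sC.
- exact: (rank_joinI PiP Pin).
Qed.

(** Here [rank_meet_perp] is an equality: the join of D and of the part of S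
    perpendicular to D is singular, so its rank is at most n. *)
Lemma generator_meet_perp S D : generator S -> sing D ->
  rank (S `&` perpset D) + rank D = n + rank (S `&` D).
Proof.
move=> [sS Sn] sD; have := rank_meet_perp PiP Pin sS sD; rewrite Sn => h.
have sSD : sing (S `&` perpset D) by apply: singI => //; exact: perpset_subspace.
have DS : D `<=` perpset (S `&` perpset D).
  by apply: perpset_sym => [|x []//]; exact: sing_sub.
have := rank_joinI PiP Pin sSD sD DS.
have -> : S `&` perpset D `&` D = S `&` D.
  apply/seteqP; split=> x; first by case=> -[].
  by case=> Sx Dx; split=> //; split=> //; case: sD => _; exact.
have := rank_le_n PiP Pin (sing_join PiP sSD sD DS).
lia.
Qed.

Lemma rank_triangle A B C : sing A -> sing B -> sing C ->
  rank (A `&` B) + rank (B `&` C) <= rank (A `&` C) + rank B.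
Proof.
move=> sA sB sC.
have [sJ JB E] := rank_join_in (singII sA sB) (singII sB sC) sB (@subIsetr _ _ _) (@subIsetl _ _ _).
have := rank_sub sJ sB JB.
have : rank (A `&` B `&` (B `&` C)) <= rank (A `&` C).
  apply: rank_sub; [exact: singII (singII _ _) (singII _ _)|exact: singII|].
  by move=> x [[Ax _] [_ Cx]].
lia.
Qed.

(** Project S onto a point u of U outside S: the result contains u and the
    hyperplane of S perpendicular to u, hence S `&` U. *)
Lemma generator_step S U : generator S -> generator U -> rank (S `&` U) < n ->
  exists S', [/\ generator S', (rank (S `&` S')).+1 = n & rank (S' `&` U) = (rank (S `&` U)).+1].
Proof.
move=> mS mU; have [sS Sn] := mS; have [sU Un] := mU; move=> lt.
have [u Uu NSu] : exists2 u, U u & ~ S u.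
  apply: contrapT => h; move: lt; rewrite setIidr ?Un ?ltnn // => u Uu.
  by apply: contrapT => NSu; apply: h; exists u.
have pu := sing_sub sU Uu.
have s1 := sing1 PiP pu.
pose H := S `&` perpset [set u].
have sH : sing H by apply: singI => //; exact: perpset_subspace.
have Hu : perpset H u.
  by split=> // x [_ /(perpset1 PiP) ux]; exact: col_sym.
have NHu : ~ H u by case.
have S1 : S `&` [set u] = set0 by apply/seteqP; split=> // x [Sx xu]; rewrite xu in Sx.
have rH : (rank H).+1 = n.
  have := generator_meet_perp mS s1; rewrite S1 (rank0 PiP Pin).
  rewrite (rank1 PiP Pin pu).
  by rewrite -/H; lia.
have rH' := rank_add PiP Pin sH Hu NHu.
have sS' := sing_add PiP sH Hu.
have mS' : generator (join Pi H [set u]) by split=> //; lia.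
exists (join Pi H [set u]); set S' := join Pi H [set u] in sS' mS' rH' *.
have S'u : S' u by exact: joinr.
have sSS' := singII sS sS'.
have lo1 : rank H <= rank (S `&` S').
  by apply: rank_sub => // x Hx; split; [case: Hx|exact: joinl].
have hi1 : rank (S `&` S') < n.
  rewrite ltnNge -Sn; apply/negP => /(rank_eq PiP Pin sS sSS' (@subIsetl _ _ _)) E.
  have [_ SS'] : S `<=` S /\ S `<=` S' by split=> // x; rewrite -E => -[].
  have E2 : S = S' by apply: (rank_eq PiP Pin) => //; lia.
  by apply: NSu; rewrite E2.
have E1 : (rank (S `&` S')).+1 = n by lia.
split=> //.
have sSU := singII sS sU; have sS'U := singII sS' sU.
have SUu : perpset (S `&` U) u by split=> // x [_ Ux]; exact: sing_col Ux Uu.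
have NSUu : ~ (S `&` U) u by case.
have lo2 : (rank (S `&` U)).+1 <= rank (S' `&` U).
  rewrite -(rank_add PiP Pin sSU SUu NSUu); apply: rank_sub => //; first exact: sing_add.
  apply: join_min; [by case: sS'U| |by move=> _ ->].
  move=> x [Sx Ux]; split=> //; apply: joinl; split=> //.
  by apply/(perpset1 PiP); exact: sing_col Uu Ux.
have := rank_triangle sS sS' sU; lia.
Qed.

Lemma generator_eq S U : generator S -> generator U -> rank (S `&` U) = n -> S = U.
Proof.
move=> [sS Sn] [sU Un] E; have sSU := singII sS sU.
have <- : S `&` U = S by apply: (rank_eq PiP Pin) => //; lia.
by apply: (rank_eq PiP Pin) => //; lia.
Qed.

Lemma dual_polar_dist S U d : generator S -> generator U ->
  dist (dual_polar_graph Pi n) S U d <-> n - rank (S `&` U) = d.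
Proof.
move=> mS mU; apply: (dist_formula (c := fun S U => n - rank (S `&` U))).
- by move=> A /= /generatorE [_ An]; rewrite setIid An subnn.
- move=> A B /generatorE mA /generatorE mB E; apply: generator_eq => //.
  by have := rank_le_n PiP Pin (singII (generator_sing mA) (generator_sing mB)); lia.
- move=> A B C /generatorE [sA An] /generatorE [sB Bn] /generatorE [sC Cn] /=.
  move=> /(has_dimP PiP Pin _ (singII sA sB)) E.
  by have := rank_triangle sA sB sC; lia.
- move=> A B k /generatorE mA /generatorE mB E.
  have [|A' [mA' E1 E2]] := generator_step mA mB; first by lia.
  exists A'; split; [exact/generatorE| |by lia].
  by apply/(has_dimP PiP Pin); [exact: singII (generator_sing _) (generator_sing _)|lia].
- exact/generatorE.
- exact/generatorE.
Qed.

Variable Gs : bool -> set (set T).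
Hypothesis GsP : parity_split (dual_polar_graph Pi n) Gs.

Lemma Gs_generator b S : Gs b S -> generator S.
Proof.
case: GsP => E _ _ GS; apply/generatorE.
have : vertices (dual_polar_graph Pi n) S by rewrite -E; case: b GS; [left|right].
exact.
Qed.

Lemma Gs_parity b c S U : Gs b S -> Gs c U -> odd (n - rank (S `&` U)) = b (+) c.
Proof.
move=> GS GU; have [_ _ /(_ b c S U GS GU) [d dd <-]] := GsP.
by have /(dual_polar_dist _ (Gs_generator GS) (Gs_generator GU)) -> := dd.
Qed.

Lemma Gs_even b S U : Gs b S -> generator U -> ~~ odd (n - rank (S `&` U)) -> Gs b U.
Proof.
move=> GS mU ev; have [E _ _] := GsP.
have : vertices (dual_polar_graph Pi n) U by exact/generatorE.
rewrite -E => -[] GU; have := Gs_parity GS GU; rewrite (negbTE ev).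
  by case: b GS.
by case: b GS.
Qed.

(** Two steps of the dual polar graph towards U lead to a neighbour in the half-spin
    graph: the codimension of its meet with S is 2, so it stays in the same half. *)
Lemma half_spin_dist b S U d : Gs b S -> Gs b U ->
  dist (half_spin_graph Pi n (Gs b)) S U d <-> n - rank (S `&` U) = d.*2.
Proof.
move=> GS GU.
have ev A B : Gs b A -> Gs b B -> (n - rank (A `&` B))./2.*2 = n - rank (A `&` B).
  move=> GA GB; have := odd_double_half (n - rank (A `&` B)).
  by rewrite (Gs_parity GA GB) addbb.
have sI A B : Gs b A -> Gs b B -> sing (A `&` B).
  by move=> /Gs_generator/generator_sing sA /Gs_generator/generator_sing sB; exact: singII.
have le A B : Gs b A -> Gs b B -> rank (A `&` B) <= n.
  by move=> GA GB; apply: (rank_le_n PiP Pin); exact: sI.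
rewrite (_ : (_ = d.*2) <-> (n - rank (S `&` U))./2 = d); last first.
  by split=> [->|<-]; [rewrite doubleK|rewrite ev].
apply: (dist_formula (c := fun S U => (n - rank (S `&` U))./2)) => //=.
- by move=> A /Gs_generator [_ An]; rewrite setIid An subnn.
- move=> A B GA GB E; apply: generator_eq; [exact: Gs_generator GA|exact: Gs_generator GB|].
  by have := ev _ _ GA GB; have := le _ _ GA GB; rewrite E; lia.
- move=> A B C GA GB GC /(has_dimP PiP Pin _ (sI _ _ GA GB)) E.
  have := rank_triangle (generator_sing (Gs_generator GA)) (generator_sing (Gs_generator GB)) (generator_sing (Gs_generator GC)).
  rewrite (proj2 (Gs_generator GB)) => tr.
  by have := ev _ _ GA GC; have := ev _ _ GB GC; lia.
- move=> A C k GA GC E; have := ev _ _ GA GC; rewrite E => E2.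
  have mA := Gs_generator GA; have mC := Gs_generator GC.
  have [|A' [mA' E3 E4]] := generator_step mA mC; first by lia.
  have [|B [mB E5 E6]] := generator_step mA' mC; first by lia.
  have AB : rank (A `&` B) + 2 = n.
    have := rank_triangle (generator_sing mA) (generator_sing mA') (generator_sing mB).
    have := rank_triangle (generator_sing mA) (generator_sing mB) (generator_sing mC).
    by rewrite (proj2 mB) (proj2 mA'); lia.
  have GB : Gs b B by apply: (Gs_even GA mB); rewrite -AB addKn.
  exists B; split=> //; last by lia.
  by apply/(has_dimP PiP Pin); [exact: sI|lia].
Qed.

End MaximalSingular.

(** * Hypercubes and half-cubes *)

Section Cube.
Variable m : nat.
Implicit Types (x y z : m.-tuple bool) (I J K : {set 'I_m}) (i j k : 'I_m).

Definition sdist I J := #|[set i | (i \in I) != (i \in J)]%SET|.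

Definition hamming x y := #|[set i | tnth x i != tnth y i]%SET|.

Definition flip x I : m.-tuple bool := [tuple tnth x i (+) (i \in I) | i < m].

Lemma flip_diff x y : flip x [set i | tnth x i != tnth y i]%SET = y.
Proof.
apply: eq_from_tnth => i; rewrite tnth_mktuple inE.
by case: (tnth x i); case: (tnth y i).
Qed.

Lemma hamming_flip x I J : hamming (flip x I) (flip x J) = sdist I J.
Proof.
apply: eq_card => i; rewrite !inE !tnth_mktuple.
by case: (tnth x i); case: (i \in I); case: (i \in J).
Qed.

Lemma flip0 x : flip x finset.set0 = x.
Proof. by apply: eq_from_tnth => i; rewrite tnth_mktuple inE addbF. Qed.

Lemma sdist0 I : sdist finset.set0 I = #|I|.
Proof. by apply: eq_card => i; rewrite !inE; case: (i \in I). Qed.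

Lemma sdistE I J : sdist I J = #|(I :\: J)%SET| + #|(J :\: I)%SET|.
Proof.
rewrite /sdist -cardsUI.
have -> : ((I :\: J) :&: (J :\: I) = finset.set0)%SET.
  by apply/finset.setP => i; rewrite !inE; case: (i \in I); case: (i \in J).
rewrite cards0 addn0; apply: eq_card => i.
by rewrite !inE; case: (i \in I); case: (i \in J).
Qed.

Lemma sdistC I J : sdist I J = sdist J I.
Proof. by rewrite !sdistE addnC. Qed.

Lemma sdist_sub I J : I \subset J -> sdist I J + #|I| = #|J|.
Proof.
move=> IJ; rewrite sdistE -(cardsID I J) (finset.setIidPr IJ) addnC.
by move: IJ; rewrite -finset.setD_eq0 => /eqP ->; rewrite cards0.
Qed.

Lemma sdist_disjoint I J : (I :&: J)%SET = finset.set0 -> sdist I J = #|I| + #|J|.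
Proof.
move=> IJ; rewrite sdistE -[in RHS](cardsID J I) -[in RHS](cardsID I J).
by rewrite (finset.setIC J) IJ cards0.
Qed.

Lemma sdist_odd I J : odd (sdist I J) = odd #|I| (+) odd #|J|.
Proof.
rewrite sdistE oddD -(cardsID J I) -(cardsID I J) !oddD finset.setIC.
by case: (odd #|(J :&: I)%SET|); rewrite //= ?addbN ?addNb ?negbK.
Qed.

Lemma hamming_triangle x y z : hamming x z <= hamming x y + hamming y z.
Proof.
apply: leq_trans (leq_card_setU _ _); apply: subset_leq_card.
apply/fintype.subsetP => i; rewrite !inE.
by case: (tnth x i); case: (tnth y i); case: (tnth z i).
Qed.

Lemma hamming0 x : hamming x x = 0.
Proof. by apply/eqP; rewrite cards_eq0; apply/eqP/finset.setP => i; rewrite !inE eqxx. Qed.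

Lemma hamming0P x y : hamming x y = 0 -> x = y.
Proof.
move/eqP; rewrite cards_eq0 => /eqP E.
by rewrite -[RHS](flip_diff x) E flip0.
Qed.

Lemma hamming_flip_sub x y I : I \subset [set i | tnth x i != tnth y i]%SET ->
  hamming (flip x I) y + #|I| = hamming x y.
Proof.
by move=> sub; rewrite -{1}(flip_diff x y) hamming_flip sdist_sub.
Qed.

Lemma hamming_flipr x I : hamming x (flip x I) = #|I|.
Proof. by rewrite -{1}(flip0 x) hamming_flip sdist0. Qed.

Lemma hypercube_dist x y d : dist (hypercube m) x y d <-> hamming x y = d.
Proof.
apply: (dist_formula (c := hamming)) => //=.
- by move=> *; exact: hamming0.
- by move=> a b _ _; exact: hamming0P.
- by move=> a b c _ _ _ ab; rewrite -add1n -ab; exact: hamming_triangle.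
- move=> a b k _ _ E.
  have [i iD] : exists i, i \in [set i | tnth a i != tnth b i]%SET.
    by apply/set0Pn; rewrite -card_gt0 -/(hamming a b) E.
  have := @hamming_flip_sub a b [set i]%SET; rewrite finset.sub1set => /(_ iD).
  rewrite cards1 E addn1 => -[E2].
  by exists (flip a [set i]%SET); split=> //; have := hamming_flipr a [set i]%SET; rewrite cards1.
Qed.

Variable C : bool -> set (m.-tuple bool).
Hypothesis CP : parity_split (hypercube m) C.

(** Each part of the parity splitting is a class for parity of the Hamming distance. *)
Lemma half_hamming b x y : C b x -> C b y <-> ~~ odd (hamming x y).
Proof.
case: CP => CT _ Cd Cx; split=> [Cy|].
  by have [d /hypercube_dist <-] := Cd b b x y Cx Cy; rewrite addbb => ->.
move=> ev; have [c Cy] : exists c, C c y.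
  have : vertices (hypercube m) y by [].
  by rewrite -CT => -[]; [exists true|exists false].
have [d /hypercube_dist <- E] := Cd b c x y Cx Cy; rewrite E in ev.
by move: ev Cy; case: b {Cx E}; case: c.
Qed.

Lemma half_nonempty b : 0 < m -> exists x, C b x.
Proof.
move=> m0; have [CT _ Cd] := CP.
pose x : m.-tuple bool := [tuple false | i < m].
have [c Cx] : exists c, C c x.
  have : vertices (hypercube m) x by [].
  by rewrite -CT => -[]; [exists true|exists false].
have [bc|bc] := eqVneq b c; first by exists x; rewrite bc.
pose y := flip x [set Ordinal m0]%SET.
have [b' Cy] : exists c, C c y.
  have : vertices (hypercube m) y by [].
  by rewrite -CT => -[]; [exists true|exists false].
have [d /hypercube_dist <- E] := Cd _ _ _ _ Cx Cy.
rewrite hamming_flipr cards1 in E.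
by exists y; move: bc E Cy; case: b; case: c {Cx}; case: b'.
Qed.

Lemma half_cube_dist b x y d : C b x -> C b y ->
  dist (half_cube m (C b)) x y d <-> hamming x y = d.*2.
Proof.
move=> Cx Cy.
have ev u v : C b u -> C b v -> (hamming u v)./2.*2 = hamming u v.
  move=> Cu /(half_hamming _ Cu) h; have := odd_double_half (hamming u v).
  by rewrite (negbTE h).
rewrite (_ : (_ = d.*2) <-> (hamming x y)./2 = d); last first.
  by split=> [->|<-]; [rewrite doubleK|rewrite ev].
apply: (dist_formula (c := fun x y => (hamming x y)./2)) => //=.
- by move=> u _; rewrite hamming0.
- by move=> u v Cu Cv E; apply: hamming0P; rewrite -ev // E.
- move=> u v w Cu Cv Cw /hypercube_dist E.
  have := hamming_triangle u v w; rewrite E -ev // -(ev v) //.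
  by lia.
- move=> u v k Cu Cv E; have := ev _ _ Cu Cv; rewrite E => E2.
  have /card_gt1P[i [j [iD jD ij]]] : 1 < #|[set i | tnth u i != tnth v i]%SET|.
    by rewrite -/(hamming u v) -E2; lia.
  have sub : [set i; j]%SET \subset [set i | tnth u i != tnth v i]%SET.
    by apply/fintype.subsetP => l; rewrite in_set2 => /orP[] /eqP ->.
  have c2 : #|[set i; j]%SET| = 2 by rewrite cards2 ij.
  have uw := hamming_flipr u [set i; j]%SET; rewrite c2 in uw.
  have := hamming_flip_sub sub; rewrite c2 => E3.
  exists (flip u [set i; j]%SET); split.
  + by apply/(half_hamming _ Cu); rewrite uw.
  + exact/hypercube_dist.
  + by lia.
Qed.
End Cube.

(** The coordinates of the embedding relative to a vertex x of the half-cube. *)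
Lemma isometry_rank (T : Type) (Pi : geometry T) (n : nat) (PiP : polar_space Pi)
    (Pin : has_rank Pi n) (Gs : bool -> set (set T))
    (GsP : parity_split (dual_polar_graph Pi n) Gs) (delta : bool) (m : nat)
    (C : bool -> set (m.-tuple bool)) (CP : parity_split (hypercube m) C) (b : bool)
    (f : m.-tuple bool -> set T)
    (fP : isometric_embedding (half_cube m (C b)) (half_spin_graph Pi n (Gs delta)) f)
    (x : m.-tuple bool) (Cx : C b x) :
  [/\ forall I : {set 'I_m}, ~~ odd #|I| -> Gs delta (f (flip x I)),
      forall I J : {set 'I_m}, ~~ odd #|I| -> ~~ odd #|J| ->
        rank Pi (f (flip x I) `&` f (flip x J)) + sdist I J = n
    & f @` C b = [set f (flip x I) | I in [set I : {set 'I_m} | ~~ odd #|I|]]].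
Proof.
have [[fG _ _] fd] := fP.
have CI (I : {set 'I_m}) : ~~ odd #|I| -> C b (flip x I).
  by move=> ev; apply/(half_hamming CP _ Cx); rewrite hamming_flipr.
split.
- by move=> I evI; exact/fG/CI.
- move=> I J evI evJ; have CxI := CI I evI; have CxJ := CI J evJ.
  have ev : hamming (flip x I) (flip x J) = (sdist I J)./2.*2.
    rewrite hamming_flip; have := odd_double_half (sdist I J).
    by rewrite sdist_odd (negbTE evI) (negbTE evJ).
  have GI : Gs delta (f (flip x I)) by exact: fG.
  have GJ : Gs delta (f (flip x J)) by exact: fG.
  have /(half_cube_dist CP _ CxI CxJ)/(fd _ _ CxI CxJ) := ev.
  move=> /(half_spin_dist PiP Pin GsP _ GI GJ).
  rewrite -ev hamming_flip.
  have := rank_le_n PiP Pin (singII (generator_sing (Gs_generator PiP Pin GsP GI))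
     (generator_sing (Gs_generator PiP Pin GsP GJ))).
  lia.
- apply/seteqP; split=> [_ [y Cy <-]|_ [I evI <-]]; last by exists (flip x I); [exact: CI|].
  exists [set i | tnth x i != tnth y i]%SET; last by rewrite flip_diff.
  exact/(half_hamming CP _ Cx).
Qed.

Lemma notin_ex m (s : seq 'I_m) : size s < m -> exists i, i \notin s.
Proof.
move=> lt; apply/existsP; apply: contraLR lt; rewrite negb_exists => /forallP h.
rewrite -leqNgt -[leqLHS]card_ord; apply: leq_trans (card_size s).
by apply: subset_leq_card; apply/fintype.subsetP => i _; have := h i; rewrite negbK.
Qed.

(** * Frames relative to a singular subspace *)

Section CrossFrame.
Variables (T : Type) (Pi : geometry T).
Hypothesis PiP : polar_space Pi.
Variable n : nat.
Hypothesis Pin : has_rank Pi n.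

Local Notation rank := (rank Pi).
Local Notation sing := (sing Pi).
Local Notation perpset := (perpset Pi).

(** A frame of the residue of M, read in the ambient space: points of the residue
    are singular subspaces of rank one more than M, and R true i, R false i are
    the two opposite points of index i. *)
Record cross_frame (M : set T) m (R : bool -> 'I_m -> set T) : Prop := {
  cross_sing : forall b i, sing (R b i);
  cross_rank : forall b i, rank (R b i) = rank M + 1;
  cross_sub : forall b i, M `<=` R b i;
  cross_perp : forall b c i j, (b == c) || (i != j) -> R b i `<=` perpset (R c j);
  cross_opp : forall i, exists x y, [/\ R false i x, R true i y & ~ collinear Pi y x] }.

Lemma cross_opposite M m (R : bool -> 'I_m -> set T) b i : cross_frame M R ->
  exists x y, [/\ R b i x, R (~~ b) i y & ~ collinear Pi y x].
Proof.
move=> RP; have [x [y [Rx Ry yx]]] := cross_opp RP i.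
case: b; last by exists x, y.
by exists y, x; split=> // xy; apply: yx; exact: col_sym.
Qed.

(** The chosen members are independent modulo M: a point y of the opposite of
    R (c i) i has a perp that contains the other chosen ones but cuts D down. *)
Lemma cross_frame_rank M m (R : bool -> 'I_m -> set T) (c : 'I_m -> bool)
    (J : {set 'I_m}) D : cross_frame M R -> sing M -> sing D -> M `<=` D ->
  (forall i, i \in J -> R (c i) i `<=` D) -> rank M + #|J| <= rank D.
Proof.
move=> RP sM; have [k] := ubnP #|J|; elim: k J D => // k IH J D cJ sD MD RD.
have [->|/set0Pn[i iJ]] := eqVneq J finset.set0.
  by rewrite cards0 addn0; exact: (rank_sub PiP Pin sM sD MD).
have [x [y [Rx Ry yx]]] := cross_opposite (c i) i RP.
have py : points Pi y by exact: sing_sub (cross_sing RP _ _) _ Ry.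
have sD' : sing (D `&` perpset [set y]) by apply: singI => //; exact: perpset_subspace.
have cJi : #|J| = #|(J :\ i)%SET|.+1 by rewrite (cardsD1 i) iJ.
have lt : rank (D `&` perpset [set y]) < rank D.
  rewrite ltnNge; apply/negP => le; apply: yx; apply/(perpset1 PiP).
  have Dx := RD i iJ x Rx; move: Dx.
  by rewrite -{1}(rank_eq PiP Pin sD sD' (@subIsetl _ _ _) le) => -[].
apply: leq_trans lt; rewrite cJi addnS ltnS; apply: IH => //; first by lia.
- move=> z Mz; split; [exact: MD|apply/(perpset1 PiP)].
  by apply: sing_col (cross_sing RP (~~ c i) i) Ry _; exact: cross_sub Mz.
- move=> j; rewrite inE => /andP[]; rewrite inE => ji jJ z Rz; split; first exact: RD Rz.
  apply/(perpset1 PiP).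
  have h : (c j == ~~ c i) || (j != i) by rewrite ji orbT.
  by have [_] := cross_perp RP h Rz; exact.
Qed.

End CrossFrame.

(** Ranks become variables before the arithmetic, so that the sets they come from
    are never compared up to conversion; unfolding [reverse_coercion] makes equal
    sets syntactically equal. *)
Ltac rank_lia :=
  cbv beta delta [reverse_coercion];
  repeat match goal with |- context [rank ?P ?A] => generalize (rank P A) end;
  repeat match goal with x := _ |- _ => clearbody x end;
  clear; intros; lia.

(** * Families of maximal singular subspaces indexed by even sets *)

Section Core.
Variables (T : Type) (Pi : geometry T).
Hypothesis PiP : polar_space Pi.
Variable n : nat.
Hypothesis Pin : has_rank Pi n.
Implicit Types (A B D X Y Z : set T) (p q x y z u w : T) (r s k : nat).

Local Notation rank := (rank Pi).
Local Notation sing := (sing Pi).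
Local Notation perpset := (perpset Pi).
Local Notation generator := (generator Pi n).

(** If the points A `&` C and B `&` C of the line C differ, they span it. *)
Lemma concurrent_or_coplanar A B C U h : sing U -> sing A -> sing B -> sing C ->
    A `<=` U -> B `<=` U -> C `<=` U -> rank C = h + 2 ->
    rank (A `&` B) = h + 1 -> rank (A `&` C) = h + 1 -> rank (B `&` C) = h + 1 ->
  A `&` B `<=` C \/ C `<=` join Pi A B.
Proof.
move=> sU sA sB sC AU BU CU rC rAB rAC rBC.
have [|NABC] := pselect (A `&` B `<=` C); [by left|right].
have sAB := singII sA sB; have sAC := singII sA sC; have sBC := singII sB sC.
have sAC_BC := singII sAC sBC.
have lt : rank (A `&` C `&` (B `&` C)) <= h.
  rewrite leqNgt; apply/negP => ge; apply: NABC.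
  have E : A `&` C `&` (B `&` C) = A `&` B.
    apply: (rank_eq PiP Pin) => //; last by lia.
    by move=> x [[Ax _] [Bx _]].
  by rewrite -E => x [[]].
have [sJ JC E] := rank_join_in PiP Pin sAC sBC sC (@subIsetr _ _ _) (@subIsetr _ _ _).
have -> : C = join Pi (A `&` C) (B `&` C).
  by apply/esym/(rank_eq PiP Pin) => //; lia.
have [sAB' _ _] := rank_join_in PiP Pin sA sB sU AU BU.
apply: join_min; first by case: sAB'.
- by move=> x [Ax _]; exact: joinl.
- by move=> x [Bx _]; exact: joinr.
Qed.

Variable m : nat.
Implicit Types (I J K : {set 'I_m}) (i j l a b : 'I_m).
Hypotheses (m_even : ~~ odd m) (m4 : 4 <= m).
Variable F : {set 'I_m} -> set T.
Hypothesis F_generator : forall I, ~~ odd #|I| -> generator (F I).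
Hypothesis F_rank : forall I J, ~~ odd #|I| -> ~~ odd #|J| ->
  rank (F I `&` F J) + sdist I J = n.

Local Notation S := (F finset.set0).
Local Notation U := (F finset.setT).
Let M := S `&` U.
Let h := rank M.
(** The family F is thought of in the space of U modulo M, where the trace of I has
    rank the cardinality of I and the traces of pairs are lines. *)
Definition trace I := F I `&` F finset.setT.
Local Notation W := trace.
Local Notation e i j := ([set i; j]%SET).

Lemma even0 : ~~ odd #|@finset.set0 'I_m|. Proof. by rewrite cards0. Qed.
Lemma evenT : ~~ odd #|[set: 'I_m]%SET|. Proof. by rewrite cardsT card_ord. Qed.
Lemma card_pair i j : i != j -> #|e i j| = 2. Proof. by move=> ij; rewrite cards2 ij. Qed.
Lemma even_pair i j : i != j -> ~~ odd #|e i j|. Proof. by move/card_pair ->. Qed.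
Local Hint Resolve even0 evenT : core.

Lemma F_sing I : ~~ odd #|I| -> sing (F I). Proof. by move/F_generator => []. Qed.

(** The meets of F K with F I and with F J have a join inside F K, of rank at most
    n; by modularity they intersect in rank at least that of F I `&` F J. *)
Lemma between I J K : ~~ odd #|I| -> ~~ odd #|J| -> ~~ odd #|K| ->
  sdist I K + sdist K J = sdist I J -> F I `&` F J `<=` F K.
Proof.
move=> eI eJ eK d; have sI := F_sing eI; have sJ := F_sing eJ; have sK := F_sing eK.
have [sX XK E] := rank_join_in PiP Pin (singII sI sK) (singII sK sJ) sK
  (@subIsetr _ _ _) (@subIsetl _ _ _).
have := rank_le_n PiP Pin sX.
have := F_rank eI eJ; have := F_rank eI eK; have := F_rank eK eJ => r1 r2 r3 r4.
have sY := singII (singII sI sK) (singII sK sJ).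
suff <- : F I `&` F K `&` (F K `&` F J) = F I `&` F J by move=> x [[]].
apply: (rank_eq PiP Pin) => //; first exact: singII.
  by move=> x [[Ix _] [_ Jx]].
lia.
Qed.

Lemma rank_MDm : h + m = n.
Proof. by rewrite -(F_rank even0 evenT) sdist0 cardsT card_ord. Qed.

Lemma trace_sing I : ~~ odd #|I| -> sing (W I).
Proof. by move=> eI; apply: singII; exact: F_sing. Qed.
Lemma Msing : sing M. Proof. by apply: singII; exact: F_sing. Qed.
Local Hint Resolve Msing : core.

Lemma trace_sub I : W I `<=` U. Proof. exact: subIsetr. Qed.

Lemma M_sub I : ~~ odd #|I| -> M `<=` F I.
Proof.
move=> eI; apply: between => //; rewrite !sdist0.
by have := sdist_sub (finset.subsetT I); lia.
Qed.

Lemma M_sub_trace I : ~~ odd #|I| -> M `<=` W I.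
Proof. by move=> eI x Mx; split; [exact: M_sub Mx|case: Mx]. Qed.

Lemma trace_rank I : ~~ odd #|I| -> rank (W I) = h + #|I|.
Proof.
move=> eI; have := F_rank eI evenT; have := sdist_sub (finset.subsetT I).
rewrite cardsT card_ord -/(trace I); have := rank_MDm; lia.
Qed.

Lemma trace_pair_rank i j : i != j -> rank (W (e i j)) = h + 2.
Proof. by move=> ij; rewrite trace_rank ?card_pair //; exact: even_pair. Qed.

Lemma trace_mono I J : ~~ odd #|I| -> ~~ odd #|J| -> I \subset J -> W I `<=` W J.
Proof.
move=> eI eJ IJ x Wx; split; last by case: Wx.
apply: (between eI evenT eJ) Wx.
have := sdist_sub IJ; have := sdist_sub (finset.subsetT I).
by have := sdist_sub (finset.subsetT J); lia.
Qed.

(** The empty set is between I and J. *)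
Lemma trace_disjoint I J : ~~ odd #|I| -> ~~ odd #|J| -> (I :&: J)%SET = finset.set0 ->
  W I `&` W J `<=` M.
Proof.
move=> eI eJ IJ x [[Ix Ux] [Jx _]]; split=> //.
apply: (between eI eJ even0) (conj Ix Jx).
by rewrite sdistC !sdist0 sdist_disjoint.
Qed.

Lemma rank_disjoint I J X : ~~ odd #|I| -> ~~ odd #|J| -> (I :&: J)%SET = finset.set0 ->
  sing X -> X `<=` W I -> X `<=` W J -> rank X <= h.
Proof.
move=> eI eJ IJ sX XI XJ; apply: (rank_sub PiP Pin) => // x Xx.
by apply: (trace_disjoint eI eJ IJ); split; [exact: XI|exact: XJ].
Qed.

Lemma trace_union I J D : ~~ odd #|I| -> ~~ odd #|J| -> (I :&: J)%SET = finset.set0 ->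
  subspace Pi D -> W I `<=` D -> W J `<=` D -> W (I :|: J)%SET `<=` D.
Proof.
move=> eI eJ IJ sD ID JD.
have cIJ : #|(I :|: J)%SET| = #|I| + #|J| by rewrite cardsU IJ cards0 subn0.
have eIJ : ~~ odd #|(I :|: J)%SET| by rewrite cIJ oddD (negbTE eI).
have [sX XW E] := rank_join_in PiP Pin (trace_sing eI) (trace_sing eJ) (trace_sing eIJ)
  (trace_mono eI eIJ (finset.subsetUl _ _)) (trace_mono eJ eIJ (finset.subsetUr _ _)).
have <- : join Pi (W I) (W J) = W (I :|: J)%SET; last exact: join_min.
apply: (rank_eq PiP Pin) => //; first exact: trace_sing.
have := rank_disjoint eI eJ IJ (singII (trace_sing eI) (trace_sing eJ)) (@subIsetl _ _ _) (@subIsetr _ _ _).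
rewrite trace_rank // cIJ; have := trace_rank eI; have := trace_rank eJ; lia.
Qed.

Lemma pairI i j a b : a != i -> a != j -> b != i -> b != j ->
  (e i j :&: e a b)%SET = finset.set0.
Proof.
move=> ai aj bi bj; apply/finset.setP => x; rewrite !inE.
apply/negP => /andP[/orP[]/eqP -> /orP[]/eqP xE].
- by rewrite xE eqxx in ai.
- by rewrite xE eqxx in bi.
- by rewrite xE eqxx in aj.
- by rewrite xE eqxx in bj.
Qed.

Lemma pairC i j : e i j = e j i. Proof. by rewrite finset.setUC. Qed.

(** Let D be the meet of F {i, j} and F {i, l}, of rank n - 2. The part of U
    perpendicular to D contains both lines and has rank 2 more than
    the meet of the two lines; modularity inside it yields the bound. *)
Lemma trace_adjacent_ge i j l : i != j -> i != l -> j != l ->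
  h + 1 <= rank (W (e i j) `&` W (e i l)).
Proof.
move=> ij il jl; have eij := even_pair ij; have eil := even_pair il.
have d2 : sdist (e i j) (e i l) = 2.
  rewrite sdistE; have -> : (e i j :\: e i l = [set j])%SET.
    apply/finset.setP => x; rewrite !inE negb_or.
    have [->|] := eqVneq x i; first by rewrite (negbTE ij).
    by have [->|] := eqVneq x j; rewrite ?jl // andbF.
  have -> : (e i l :\: e i j = [set l])%SET; last by rewrite !cards1.
  apply/finset.setP => x; rewrite !inE negb_or.
  have [->|] := eqVneq x i; first by rewrite (negbTE il).
  by have [->|] := eqVneq x l; rewrite ?(eq_sym l j) ?jl // andbF.
have sD : sing (F (e i j) `&` F (e i l)) by apply: singII; exact: F_sing.
have := F_rank eij eil; rewrite d2 => rD.
have := generator_meet_perp PiP Pin (F_generator evenT) sD.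
have -> : U `&` (F (e i j) `&` F (e i l)) = W (e i j) `&` W (e i l).
  by apply/seteqP; split=> x; [case=> ? [? ?]|case=> -[? ?] [? ?]].
set H := U `&` perpset _; have sH : sing H.
  by apply: singI; [exact: F_sing|exact: perpset_subspace].
have WH a : i != a -> F (e i j) `&` F (e i l) `<=` F (e i a) -> W (e i a) `<=` H.
  move=> ia sub x [Fx Ux]; split=> //; apply: (perpset_anti sub).
  by case: (F_sing (even_pair ia)) => _; exact.
have [sX XH E] := rank_join_in PiP Pin (trace_sing eij) (trace_sing eil) sH
  (WH j ij (@subIsetl _ _ _)) (WH l il (@subIsetr _ _ _)).
have := rank_sub PiP Pin sX sH XH.
have := trace_pair_rank ij; have := trace_pair_rank il; lia.
Qed.

Lemma other3 i j l : exists a, [/\ a != i, a != j & a != l].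
Proof.
have [|a] := @notin_ex m [:: i; j; l]; first exact: m4.
by rewrite !inE !negb_or => /and3P[? ? ?]; exists a.
Qed.

(** Were the two lines equal, the line of {l, a} would meet the line of the
    disjoint pair {i, j}, since it meets the line of {i, l}. *)
Lemma trace_adjacent i j l : i != j -> i != l -> j != l ->
  rank (W (e i j) `&` W (e i l)) = h + 1.
Proof.
move=> ij il jl; apply/eqP; rewrite eqn_leq trace_adjacent_ge // andbT leqNgt.
apply/negP => gt.
have sij := trace_sing (even_pair ij); have sil := trace_sing (even_pair il).
have Eij : W (e i j) `&` W (e i l) = W (e i j).
  apply: (rank_eq PiP Pin) => //; first exact: singII.
  by rewrite trace_pair_rank //; lia.
have Eil : W (e i j) `&` W (e i l) = W (e i l).
  apply: (rank_eq PiP Pin) => //; first exact: singII.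
  by rewrite trace_pair_rank //; lia.
have [a [ai aj al]] := other3 i j l.
have la : l != a by rewrite eq_sym.
have li : l != i by rewrite eq_sym.
have lj : l != j by rewrite eq_sym.
have ela := even_pair la.
have := @rank_disjoint (e i j) (e l a) (W (e l i) `&` W (e l a)) (even_pair ij) ela
  (pairI li lj ai aj) (singII (trace_sing (even_pair li)) (trace_sing ela)).
have ia : i != a by rewrite eq_sym.
have := trace_adjacent_ge li la ia.
rewrite (pairC l i) -Eil Eij => ge /(_ (@subIsetl _ _ _) (@subIsetr _ _ _)); lia.
Qed.

Definition concurrent i j l a := W (e i j) `&` W (e i l) `<=` W (e i a).

Definition star := forall i j l a, uniq [:: i; j; l; a] -> concurrent i j l a.

Lemma uniq4 i j l a : uniq [:: i; j; l; a] ->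
  [/\ i != j, i != l, i != a & [/\ j != l, j != a & l != a]].
Proof. by rewrite /= !inE !negb_or => /and4P[/and3P[? ? ?] /andP[? ?] ? _]. Qed.

Lemma nonconcurrent_plane i j l a : uniq [:: i; j; l; a] -> ~ concurrent i j l a ->
  W (e i a) `<=` join Pi (W (e i j)) (W (e i l)).
Proof.
move=> /uniq4[ij il ia [jl ja la]] NC.
have := @concurrent_or_coplanar (W (e i j)) (W (e i l)) (W (e i a)) U h (F_sing evenT)
  (trace_sing (even_pair ij)) (trace_sing (even_pair il)) (trace_sing (even_pair ia))
  (@trace_sub _) (@trace_sub _) (@trace_sub _) (trace_pair_rank ia) (trace_adjacent ij il jl)
  (trace_adjacent ij ia ja) (trace_adjacent il ia la).
by case.
Qed.

(** A sixth index c is what rules out the coplanar configuration. *)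
Lemma star6 : 6 <= m -> star.
Proof.
move=> m6 i j l a uq; apply: contrapT => NC.
have pl := nonconcurrent_plane uq NC; have [ij il ia [jl ja la]] := uniq4 uq.
have [|b] := @notin_ex m [:: i; j; l; a]; first exact: leq_trans m6.
rewrite !inE !negb_or => /and4P[bi bj bl ba].
have [|c] := @notin_ex m [:: i; j; l; a; b]; first exact: m6.
rewrite !inE !negb_or => /and5P[ci cj cl ca cb].
(* The plane lies in the trace of {i, j, l, b}, which is skew to the line of {a, c}. *)
pose I := (e i j :|: e l b)%SET.
have dj : (e i j :&: e l b)%SET = finset.set0.
  by apply: pairI => //; rewrite eq_sym.
have lb : l != b by rewrite eq_sym.
have eI : ~~ odd #|I| by rewrite cardsU dj cards0 !card_pair.
have sub (x y : 'I_m) : x \in I -> y \in I -> x != y -> W (e x y) `<=` W I.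
  move=> xI yI xy; apply: trace_mono => //; first exact: even_pair.
  by apply/fintype.subsetP => z; rewrite in_set2 => /orP[]/eqP ->.
have WaI : W (e i a) `<=` W I.
  apply: subset_trans pl _; apply: join_min; first by case: (trace_sing eI).
    by apply: sub => //; rewrite !inE eqxx ?orbT.
  by apply: sub => //; rewrite !inE eqxx ?orbT.
have ac : a != c by rewrite eq_sym.
have ai : a != i by rewrite eq_sym.
have ic : i != c by rewrite eq_sym.
have dI : (I :&: e a c)%SET = finset.set0.
  apply/finset.setP => x; rewrite !inE; apply/negP => /andP[xI /orP[]/eqP xE];
  move: xI; rewrite xE.
  - by rewrite (negbTE ai) (eq_sym a j) (negbTE ja) (eq_sym a l) (negbTE la) (eq_sym a b) (negbTE ba).
  - by rewrite (negbTE ci) (negbTE cj) (negbTE cl) (negbTE cb).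
have eac := even_pair ac.
have sX := singII (trace_sing (even_pair ai)) (trace_sing eac).
have XI : W (e a i) `&` W (e a c) `<=` W I.
  by move=> x []; rewrite pairC => /WaI.
have := rank_disjoint eI eac dI sX XI (@subIsetr _ _ _).
by rewrite trace_adjacent // addn1 ltnn.
Qed.

(** Otherwise the line of {j, l} would lie in the plane of the lines through i, as
    does the line of {i, a}, and two lines of a plane meet, whereas these two
    pairs are disjoint. *)
Lemma nonconcurrent_triangle i j l a : uniq [:: i; j; l; a] -> ~ concurrent i j l a ->
  W (e i j) `&` W (e i l) `<=` W (e j l).
Proof.
move=> uq NC; have pl := nonconcurrent_plane uq NC.
have [ij il ia [jl ja la]] := uniq4 uq.
have eij := even_pair ij; have eil := even_pair il; have eia := even_pair ia.
have ejl := even_pair jl.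
have ji : j != i by rewrite eq_sym.
have li : l != i by rewrite eq_sym.
have lj : l != j by rewrite eq_sym.
have r1 : rank (W (e i j) `&` W (e j l)) = h + 1 by rewrite (pairC i j) trace_adjacent.
have r2 : rank (W (e i l) `&` W (e j l)) = h + 1.
  by rewrite (pairC i l) (pairC j l) trace_adjacent.
have [//|pl2] := concurrent_or_coplanar (F_sing evenT) (trace_sing eij) (trace_sing eil) (trace_sing ejl)
  (@trace_sub _) (@trace_sub _) (@trace_sub _) (trace_pair_rank jl) (trace_adjacent ij il jl) r1 r2.
have [sJ _ rJ] := rank_join_in PiP Pin (trace_sing eij) (trace_sing eil) (F_sing evenT) (@trace_sub _) (@trace_sub _).
have [sX XJ rX] := rank_join_in PiP Pin (trace_sing ejl) (trace_sing eia) sJ pl2 pl.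
have := rank_sub PiP Pin sX sJ XJ.
have aj : a != j by rewrite eq_sym.
have al : a != l by rewrite eq_sym.
have := rank_disjoint ejl eia (pairI ij il aj al) (singII (trace_sing ejl) (trace_sing eia))
  (@subIsetl _ _ _) (@subIsetr _ _ _).
have r0 := trace_adjacent ij il jl; rewrite !trace_pair_rank // in rJ rX.
by move=> r3 r4; exfalso; move: r0 r3 r4 rJ rX; rank_lia.
Qed.

Definition nonconcurrent i j l a := uniq [:: i; j; l; a] /\ ~ concurrent i j l a.

Lemma uniq4I i j l a : i != j -> i != l -> i != a -> j != l -> j != a -> l != a ->
  uniq [:: i; j; l; a].
Proof. by move=> ij il ia jl ja la; rewrite /= !inE !negb_or ij il ia jl ja la. Qed.

Lemma nonconcurrent_swap23 i j l a : nonconcurrent i j l a -> nonconcurrent i l j a.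
Proof.
move=> [uq NC]; split; last by rewrite /concurrent setIC.
by have [? ? ? [? ? ?]] := uniq4 uq; apply: uniq4I => //; rewrite eq_sym.
Qed.

Lemma nonconcurrent_swap34 i j l a : nonconcurrent i j l a -> nonconcurrent i j a l.
Proof.
move=> [uq NC]; have [ij il ia [jl ja la]] := uniq4 uq.
split; first by apply: uniq4I => //; rewrite eq_sym.
move=> C; apply: NC; have sub : W (e i j) `&` W (e i a) `<=` W (e i j) `&` W (e i l).
  by move=> x Wx; split; [case: Wx|exact: C].
have sij := trace_sing (even_pair ij); have sil := trace_sing (even_pair il).
have sia := trace_sing (even_pair ia).
have E : W (e i j) `&` W (e i a) = W (e i j) `&` W (e i l).
  apply: (rank_eq PiP Pin) => //; try exact: singII.
  by rewrite !trace_adjacent.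
by rewrite /concurrent -E => x [].
Qed.

(** The point common to the lines of {i, j} and {i, l} is on the line of {j, l}. If
    the lines at j were concurrent, it would be on the line of {j, a} too, which
    is skew to that of {i, l}. *)
Lemma nonconcurrent_swap12 i j l a : nonconcurrent i j l a -> nonconcurrent j i l a.
Proof.
move=> [uq NC]; have [ij il ia [jl ja la]] := uniq4 uq.
have ji : j != i by rewrite eq_sym.
split; first by apply: uniq4I => //; rewrite eq_sym.
move=> C; have T3 := nonconcurrent_triangle uq NC.
have eil := even_pair il; have eja := even_pair ja.
have sX := singII (trace_sing (even_pair ij)) (trace_sing eil).
have Xja : W (e i j) `&` W (e i l) `<=` W (e j a).
  by move=> x Xx; apply: C; split; [rewrite pairC; case: Xx|exact: T3].
have ai : a != i by rewrite eq_sym.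
have al : a != l by rewrite eq_sym.
have := rank_disjoint eil eja (pairI ji jl ai al) sX (@subIsetr _ _ _) Xja.
by rewrite trace_adjacent // addn1 ltnn.
Qed.

(** The three transpositions above generate all permutations of four indices. *)
Lemma nonconcurrent_all i j l a : m = 4 -> nonconcurrent i j l a ->
  forall i' j' l' a', uniq [:: i'; j'; l'; a'] -> nonconcurrent i' j' l' a'.
Proof.
move=> m_eq NC.
have all4 (s : seq 'I_m) : uniq s -> size s = 4 -> forall b, b \in s.
  move=> us ss b.
  have : #|s| = #|'I_m| by rewrite (card_uniqP us) ss card_ord m_eq.
  by move/subset_cardP => /(_ (subset_predT _)) ->.
have front b : exists j l a, nonconcurrent b j l a.
  have := all4 _ (proj1 NC) erefl b; rewrite !inE => /or4P[]/eqP ->.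
  - by exists j, l, a.
  - by exists i, l, a; exact: nonconcurrent_swap12.
  - by exists i, j, a; exact/nonconcurrent_swap12/nonconcurrent_swap23.
  - exists i, j, l; apply/nonconcurrent_swap12/nonconcurrent_swap23.
    exact: nonconcurrent_swap34.
move=> i' j' l' a' uq; have [b [c [d NC']]] := front i'.
have [ij il ia [jl ja la]] := uniq4 uq.
have memb := all4 _ (proj1 NC') erefl.
move: (memb j') (memb l') (memb a'); rewrite !inE.
rewrite !(eq_sym _ i') (negbTE ij) (negbTE il) (negbTE ia) /=.
have H2 := nonconcurrent_swap23 NC'; have H3 := nonconcurrent_swap34 NC'.
have H4 := nonconcurrent_swap34 H2; have H5 := nonconcurrent_swap23 H3.
have H6 := nonconcurrent_swap23 H4.
case/or3P => /eqP jE; case/or3P => /eqP lE; case/or3P => /eqP aE;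
  move: jl ja la; rewrite jE lE aE ?eqxx // => _ _ _.
Qed.

Lemma triangles_concurrent : m = 4 -> ~ star -> forall i j l a, uniq [:: i; j; l; a] ->
  W (e i j) `&` W (e i l) `<=` W (e j l).
Proof.
move=> m_eq Nst i j l a uq.
have [i0 [j0 [l0 [a0 NC]]]] : exists i j l a, nonconcurrent i j l a.
  apply: contrapT => H; apply: Nst => i0 j0 l0 a0 uq0.
  by apply: contrapT => NC; apply: H; exists i0, j0, l0, a0.
have [_ NC'] := nonconcurrent_all m_eq NC uq.
exact: nonconcurrent_triangle uq NC'.
Qed.

Hypothesis st : star.

(** The common point of the lines of index i: two of them suffice ([poleE]). *)
Definition pole i := [set x | forall j, j != i -> W (e i j) x].
Local Notation P := pole.

Lemma poleE i j l : j != i -> l != i -> j != l -> P i = W (e i j) `&` W (e i l).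
Proof.
move=> ji li jl; apply/seteqP; split=> x; first by move=> Px; split; exact: Px.
move=> Wx a ai; have [->|aj] := eqVneq a j; first by case: Wx.
have [->|al] := eqVneq a l; first by case: Wx.
by apply: (st _ Wx); apply: uniq4I => //; rewrite eq_sym.
Qed.

Lemma two_others i : exists j l, [/\ j != i, l != i & j != l].
Proof.
have [a [ai _ _]] := other3 i i i; have [b [bi ba _]] := other3 i a a.
by exists a, b; split=> //; rewrite eq_sym.
Qed.

Lemma pole_sing i : sing (P i).
Proof.
have [j [l [ji li jl]]] := two_others i; rewrite (poleE ji li jl).
by apply: singII; apply/trace_sing/even_pair; rewrite eq_sym.
Qed.

Lemma pole_rank i : rank (P i) = h + 1.
Proof.
have [j [l [ji li jl]]] := two_others i; rewrite (poleE ji li jl).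
by apply: trace_adjacent => //; rewrite eq_sym.
Qed.

Lemma M_sub_pole i : M `<=` P i.
Proof. by move=> x Mx j ji; apply: M_sub_trace Mx; apply: even_pair; rewrite eq_sym. Qed.

Lemma pole_sub_trace i I : ~~ odd #|I| -> i \in I -> P i `<=` W I.
Proof.
move=> eI iI.
have [j jI ji] : exists2 j, j \in I & j != i.
  have : 0 < #|(I :\ i)%SET| by move: eI; rewrite (cardsD1 i) iI; case: #|_|.
  by case/card_gt0P => j; rewrite !inE => /andP[? ?]; exists j.
move=> x /(_ j ji); apply: trace_mono => //; first by apply: even_pair; rewrite eq_sym.
by apply/fintype.subsetP => a; rewrite in_set2 => /orP[]/eqP ->.
Qed.

Lemma pole_sub i : P i `<=` U.
Proof. by move=> x /(pole_sub_trace evenT (finset.in_setT i)) []. Qed.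

Lemma pole_join i j D : i != j -> subspace Pi D -> P i `<=` D -> P j `<=` D ->
  W (e i j) `<=` D.
Proof.
move=> ij sD Di Dj; have eij := even_pair ij.
have [a [ai aj _]] := other3 i j j; have [b [bi bj ba]] := other3 i j a.
have ia : i != a by rewrite eq_sym.
have jb : j != b by rewrite eq_sym.
have ab : a != b by rewrite eq_sym.
have ji : j != i by rewrite eq_sym.
have sI := singII (pole_sing i) (pole_sing j).
have le : rank (P i `&` P j) <= h.
  apply: (rank_disjoint (even_pair ia) (even_pair jb) (pairI ji _ bi ba) sI) => //.
  - by rewrite eq_sym.
  - by move=> x [/(_ a ai)].
  - by move=> x [_ /(_ b bj)].
have PiW : P i `<=` W (e i j) by apply: pole_sub_trace => //; rewrite !inE eqxx.
have PjW : P j `<=` W (e i j) by apply: pole_sub_trace => //; rewrite !inE eqxx orbT.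
have [sX XW E] := rank_join_in PiP Pin (pole_sing i) (pole_sing j) (trace_sing eij) PiW PjW.
have <- : join Pi (P i) (P j) = W (e i j); last exact: join_min.
apply: (rank_eq PiP Pin) => //; first exact: trace_sing.
by rewrite trace_pair_rank //; move: le E; rewrite !pole_rank; rank_lia.
Qed.

(** The poles of I span the trace of I: remove a pair from I, whose line is spanned
    by its two poles, and recall that traces of disjoint sets span that of the
    union. *)
Lemma pole_span I D : ~~ odd #|I| -> subspace Pi D -> M `<=` D ->
  (forall i, i \in I -> P i `<=` D) -> W I `<=` D.
Proof.
move=> eI sD MD; have [k cI] := ubnP #|I|; elim: k I cI eI => // k IH I cI eI PD.
have [->|/set0Pn[i iI]] := eqVneq I finset.set0; first by move=> x [? ?]; exact: MD.
have [j jI ji] : exists2 j, j \in I & j != i.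
  have : 0 < #|(I :\ i)%SET| by move: eI; rewrite (cardsD1 i) iI; case: #|_|.
  by case/card_gt0P => j; rewrite !inE => /andP[? ?]; exists j.
have ij : i != j by rewrite eq_sym.
have sub : e i j \subset I.
  by apply/fintype.subsetP => a; rewrite in_set2 => /orP[]/eqP ->.
have cD : #|(I :\: e i j)%SET| + 2 = #|I|.
  by rewrite -(cardsID (e i j) I) (finset.setIidPr sub) card_pair // addnC.
have eD : ~~ odd #|(I :\: e i j)%SET| by move: eI; rewrite -cD oddD addbF.
have -> : I = (e i j :|: (I :\: e i j))%SET.
  by rewrite -{1}(finset.setID I (e i j)) (finset.setIidPr sub).
apply: trace_union => //; first exact: even_pair.
- by apply/finset.setP => a; rewrite !inE; case: (_ || _); rewrite ?andbF.
- by apply: pole_join => //; exact: PD.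
- apply: IH => //; first by lia.
  by move=> a; rewrite inE => /andP[_]; exact: PD.
Qed.

(** The dual basis in S. *)
Definition antipole i := S `&` perpset [set x | exists2 j, j != i & P j x].
Local Notation Q := antipole.

Lemma antipole_sing i : sing (Q i).
Proof. by apply: singI; [exact: F_sing|exact: perpset_subspace]. Qed.

Lemma M_sub_antipole i : M `<=` Q i.
Proof.
move=> x [Sx Ux]; split=> //; split; first exact: sing_sub (F_sing even0) _ Sx.
by move=> y [j _ /pole_sub Uy]; exact: sing_col (F_sing evenT) Uy Ux.
Qed.

(** F I is spanned by its parts in S and in U; x is perpendicular to the latter by
    [pole_span], and F I is maximal. *)
Lemma antipole_sub i I : ~~ odd #|I| -> i \notin I -> Q i `<=` F I.
Proof.
move=> eI iI x [Sx [px Px]]; apply: (generator_perp PiP Pin (F_generator eI)).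
have WX : W I `<=` perpset [set x].
  apply: pole_span => //; first exact: perpset_subspace.
    move=> y [Sy _]; apply/(perpset1 PiP); exact: sing_col (F_sing even0) Sx Sy.
  move=> j jI y Py; apply/(perpset1 PiP)/col_sym; apply: Px; exists j => //.
  by apply: contraNneq iI => <-.
have ZX : F I `&` S `<=` perpset [set x].
  by move=> y [_ Sy]; apply/(perpset1 PiP); exact: sing_col (F_sing even0) Sx Sy.
have sZ := singII (F_sing eI) (F_sing even0); have sW := trace_sing eI.
have [sX XF E] := rank_join_in PiP Pin sZ sW (F_sing eI) (@subIsetl _ _ _) (@subIsetl _ _ _).
have FX : F I = join Pi (F I `&` S) (W I).
  apply/esym/(rank_eq PiP Pin) => //; first exact: F_sing.
  have sM := singII sZ sW.
  have le : rank (F I `&` S `&` W I) <= h.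
    by apply: (rank_sub PiP Pin) => // y [[_ ?] [_ ?]].
  have := F_rank eI even0; rewrite sdistC sdist0 (proj2 (F_generator eI)) => E2.
  by move: le E E2 (trace_rank eI); rank_lia.
split=> // y; rewrite FX => /(join_min (perpset_subspace PiP _) ZX WX).
move/(perpset1 PiP); exact: col_sym.
Qed.

(** The poles span U, and a point of S perpendicular to U is in U. *)
Lemma antipole_perp i x : Q i x -> (forall y, P i y -> collinear Pi y x) -> M x.
Proof.
move=> [Sx [px Px]] Py; split=> //; apply: (generator_perp PiP Pin (F_generator evenT)).
have : W finset.setT `<=` perpset [set x].
  apply: pole_span => //; first exact: perpset_subspace.
    move=> z [Sz _]; apply/(perpset1 PiP); exact: sing_col (F_sing even0) Sx Sz.
  move=> j _ z Pz; apply/(perpset1 PiP)/col_sym.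
  by have [ji|ji] := eqVneq j i; [apply: Py; rewrite -ji|apply: Px; exists j].
move=> sub; split=> // z Uz.
by apply: col_sym; apply/(perpset1 PiP); exact: sub (conj Uz Uz).
Qed.

(** The poles of index different from i lie in a hyperplane of U: the trace of the
    complement of a pair {i, j} joined with the pole of j. *)
Lemma antipole_ge i : h + 1 <= rank (Q i).
Proof.
have [j [_ [ji _ _]]] := two_others i.
have ij : i != j by rewrite eq_sym.
pose I := (finset.setT :\: e i j)%SET.
have cI : #|I| + 2 = m.
  have := cardsID (e i j) finset.setT; rewrite finset.setTI card_pair // cardsT card_ord.
  by rewrite addnC.
have eI : ~~ odd #|I| by move: m_even; rewrite -[X in odd X]cI oddD addbF.
have sW := trace_sing eI; have sP := pole_sing j.
have [sH _ E] := rank_join_in PiP Pin sW sP (F_sing evenT) (@trace_sub _) (@pole_sub _).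
have sSH : S `&` perpset (join Pi (W I) (P j)) `<=` Q i.
  move=> x [Sx Hx]; split=> //; apply: perpset_anti Hx => y [l li Ply].
  have [lj|lj] := eqVneq l j; first by apply: joinr; rewrite -lj.
  by apply: joinl; apply: (pole_sub_trace eI _ Ply); rewrite !inE negb_or li lj.
have le1 : h <= rank (W I `&` P j).
  apply: (rank_sub PiP Pin) => //; first exact: singII.
  by move=> x Mx; split; [exact: M_sub_trace Mx|exact: M_sub_pole Mx].
have le2 : h <= rank (S `&` join Pi (W I) (P j)).
  apply: (rank_sub PiP Pin) => //; first by apply: singII => //; exact: F_sing.
  by move=> x Mx; split; [case: Mx|apply: joinl; exact: M_sub_trace Mx].
have le3 : rank (S `&` perpset (join Pi (W I) (P j))) <= rank (Q i).
  apply: (rank_sub PiP Pin) => //; last exact: antipole_sing.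
  by apply: singI; [exact: F_sing|exact: perpset_subspace].
have E2 := generator_meet_perp PiP Pin (F_generator even0) sH.
move: E E2 le1 le2 le3 (trace_rank eI) rank_MDm; rewrite pole_rank => E E2 le1 le2 le3 rI hmn.
move: cI E E2 le1 le2 le3 rI hmn; move: #|I|; rank_lia.
Qed.

Lemma opposite i : exists x y, [/\ Q i x, P i y & ~ collinear Pi y x].
Proof.
apply: contrapT => H; have QM : Q i `<=` M.
  move=> x Qx; apply: (antipole_perp Qx) => y Py.
  by apply: contrapT => yx; apply: H; exists x, y.
have := leq_trans (antipole_ge i) (rank_sub PiP Pin (antipole_sing i) Msing QM).
by rewrite addn1 ltnn.
Qed.

Lemma antipole_rank i : rank (Q i) = h + 1.
Proof.
apply/eqP; rewrite eqn_leq antipole_ge andbT.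
have [x [y [Qx Py yx]]] := opposite i.
have py : points Pi y by exact: sing_sub (pole_sing i) _ Py.
have sQ := antipole_sing i.
have My : ~ M y.
  by case=> Sy _; apply: yx; case: Qx => Sx _; exact: sing_col (F_sing even0) Sy Sx.
have My' : perpset M y.
  apply: perpset_anti (_ : perpset (P i) y); first exact: M_sub_pole.
  by case: (pole_sing i) => _; exact.
have PE : P i = join Pi M [set y].
  have rJ := rank_add PiP Pin Msing My' My.
  apply/esym/(rank_eq PiP Pin); first exact: pole_sing.
  - exact: sing_add.
  - by apply: join_min; [case: (pole_sing i)|exact: M_sub_pole|move=> _ ->].
  - by rewrite pole_rank rJ addn1.
have le : rank (Q i `&` perpset [set y]) <= h.
  apply: (rank_sub PiP Pin) => //.
    by apply: singI => //; exact: perpset_subspace.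
  move=> z [Qz /(perpset1 PiP) yz]; apply: (antipole_perp Qz) => w; rewrite PE.
  have [Sz _] := Qz; have : perpset M z.
    split; first exact: col_ptr yz.
    by move=> t [St _]; exact: sing_col (F_sing even0) St Sz.
  by move=> /(perp_join PiP (col_sym yz))[_]; apply.
have := rank_drop PiP Pin sQ py; move: le; rank_lia.
Qed.

Definition cross (c : bool) i := if c then P i else Q i.

Lemma cross_frameP : cross_frame Pi M cross.
Proof.
split.
- by move=> [] i; [exact: pole_sing|exact: antipole_sing].
- by move=> [] i; [exact: pole_rank|exact: antipole_rank].
- by move=> [] i; [exact: M_sub_pole|exact: M_sub_antipole].
- move=> [] [] i j /= ij.
  + exact: sub_perp (F_sing evenT) (@pole_sub i) (@pole_sub j).
  + move=> y Py; split; first exact: sing_sub (pole_sing i) _ Py.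
    by move=> z [_ [_ Pz]]; apply/col_sym/Pz; exists i.
  + move=> y [Sy [py Py]]; split=> // z Pz; apply: Py; exists j => //.
    by rewrite eq_sym.
  + by apply: sub_perp (F_sing even0) _ _ => y [].
- exact: opposite.
Qed.

(** Given V, let I be the set of i whose pole is in V. The meets of V with S and
    with U have rank at least rank M + (m - |I|) and rank M + |I|, and
    modularity in V turns both into equalities. So |I| is the distance from S to
    V, which is even; and V `&` F I contains m independent members of the frame. *)
Lemma cross_image (Gs : bool -> set (set T))
    (GsP : parity_split (dual_polar_graph Pi n) Gs) (delta : bool) :
    (forall I, ~~ odd #|I| -> Gs delta (F I)) ->
  [set F I | I in [set I : {set 'I_m} | ~~ odd #|I|]] =
  [set V | [/\ Gs delta V, M `<=` V & forall i, exists c, cross c i `<=` V]].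
Proof.
move=> GF; apply/seteqP; split=> [_ [I eI <-]|V [GV MV RV]].
  split; [exact: GF|exact: M_sub|].
  move=> i; have [iI|iI] := boolP (i \in I).
    by exists true => y /(pole_sub_trace eI iI) [].
  by exists false; exact: antipole_sub.
pose I := [set i | `[< P i `<=` V >]]%SET.
have RI i : cross (i \in I) i `<=` V.
  rewrite inE; have [//|RV'] := asboolP (P i `<=` V).
  by have [[|//]] := RV i.
have mV := Gs_generator PiP Pin GsP GV; have sV := generator_sing mV.
have sS := F_sing even0; have sU := F_sing evenT.
have lo1 : h + #|(~: I)%SET| <= rank (S `&` V).
  apply: (cross_frame_rank PiP Pin (c := fun=> false) cross_frameP) => [||y My|i].
  - exact: Msing.
  - exact: singII.
  - by split; [case: My|exact: MV].
  - rewrite inE => iI y Ry; split; first by case: Ry.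
    by apply: (RI i); rewrite (negbTE iI).
have lo2 : h + #|I| <= rank (V `&` U).
  apply: (cross_frame_rank PiP Pin (c := fun=> true) cross_frameP) => [||y My|i].
  - exact: Msing.
  - exact: singII.
  - by split; [exact: MV|case: My].
  - move=> iI y Ry; split; last exact: pole_sub Ry.
    by apply: (RI i); rewrite iI.
have cI : #|(~: I)%SET| + #|I| = m by rewrite addnC cardsC card_ord.
have tr := rank_triangle PiP Pin sS sV sU; rewrite (proj2 mV) -/M -/h in tr.
have rSV : n - rank (S `&` V) = #|I|.
  by move: rank_MDm lo1 lo2 cI tr; move: #|_| #|_|; rank_lia.
have eI : ~~ odd #|I|.
  by rewrite -rSV (Gs_parity PiP Pin GsP (GF _ even0) GV) addbb.
exists I => //; apply: (generator_eq PiP Pin (F_generator eI) mV).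
have sFV : sing (F I `&` V) by apply: singII => //; exact: F_sing.
apply/eqP; rewrite eqn_leq (rank_le_n PiP Pin) //=.
rewrite -rank_MDm -[X in _ + X](card_ord m) -cardsT.
apply: (cross_frame_rank PiP Pin (c := fun i => i \in I) cross_frameP) => // [y My|i _ y Ry].
  by split; [exact: (M_sub eI)|exact: MV].
split; last exact: (RI i _ Ry).
move: Ry; rewrite /cross; have [iI|iI] := boolP (i \in I).
  by move=> /(pole_sub_trace eI iI) [].
exact: antipole_sub.
Qed.

End Core.

(** * The exceptional automorphism of the half-cube of dimension 4 *)

Section PairSwap.
Variable m : nat.
Hypothesis m_eq : m = 4.
Implicit Types (I J : {set 'I_m}) (i j l a : 'I_m).

Definition pair_swap I : {set 'I_m} := if #|I| == 2 then (~: I)%SET else I.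

Lemma card_compl I : #|(~: I)%SET| + #|I| = 4.
Proof. by rewrite addnC cardsC card_ord. Qed.

Lemma cardsT4 : #|[set: 'I_m]%SET| = 4.
Proof. by rewrite cardsT card_ord. Qed.

Lemma card_compl2 I : #|I| = 2 -> #|(~: I)%SET| = 2.
Proof. by have := card_compl I => /[swap] ->; rewrite -[4]/(2 + 2) => /addIn. Qed.

Lemma card_pair_swap I : #|pair_swap I| = #|I|.
Proof. by rewrite /pair_swap; case: eqP => // I2; have := card_compl I; lia. Qed.

Lemma pair_swapK : involutive pair_swap.
Proof.
move=> I; rewrite {1}/pair_swap card_pair_swap /pair_swap.
by case: eqP => // _; rewrite finset.setCK.
Qed.

Lemma sdist_compl I J : sdist (~: I)%SET (~: J)%SET = sdist I J.
Proof. by apply: eq_card => i; rewrite !inE; case: (i \in I); case: (i \in J). Qed.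

Lemma sdist_middle I J : #|I| = 2 -> ~~ odd #|J| -> #|J| != 2 -> sdist I J = 2.
Proof.
move=> I2 eJ J2; have cJ := card_compl J.
have [J0|J4] : #|J| = 0 \/ #|J| = 4 by move: #|J| eJ J2 cJ => [|[|[|[|[|k]]]]] //; lia.
  by rewrite (cards0_eq J0) sdistC sdist0.
have -> : J = [set: 'I_m]%SET.
  by apply/eqP; rewrite eqEcard finset.subsetT cardsT4 J4.
by have := sdist_sub (finset.subsetT I); rewrite cardsT4 I2; lia.
Qed.

Lemma sdist_pair_swap I J : ~~ odd #|I| -> ~~ odd #|J| ->
  sdist (pair_swap I) (pair_swap J) = sdist I J.
Proof.
move=> eI eJ; rewrite /pair_swap; case: eqP => [I2|/eqP I2]; case: eqP => [J2|/eqP J2] //.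
- exact: sdist_compl.
- by rewrite !sdist_middle // card_compl2.
- by rewrite ![sdist I _]sdistC !sdist_middle // card_compl2.
Qed.

Lemma compl_pair i j l a : uniq [:: i; j; l; a] -> (~: [set i; j] = [set l; a])%SET.
Proof.
move=> uq; apply/esym/eqP; rewrite eqEcard.
have [ij il ia [jl ja la]] := uniq4 uq; apply/andP; split.
  apply/fintype.subsetP => x; rewrite !inE => /orP[]/eqP ->.
    by rewrite negb_or !(eq_sym l) il jl.
  by rewrite negb_or !(eq_sym a) ia ja.
by rewrite card_compl2 !card_pair.
Qed.

End PairSwap.

Section HalfCubeImage.
Variables (T : Type) (Pi : geometry T).
Hypothesis PiP : polar_space Pi.
Variable n : nat.
Hypothesis Pin : has_rank Pi n.

Local Notation rank := (rank Pi).
Local Notation sing := (sing Pi).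
Local Notation perpset := (perpset Pi).

(** For m = 4, complementing the pairs turns the three lines of a triangle into
    three lines with a common index. *)
Lemma star_exists m (F : {set 'I_m} -> set T) : ~~ odd m -> 4 <= m ->
    (forall I : {set 'I_m}, ~~ odd #|I| -> generator Pi n (F I)) ->
    (forall I J : {set 'I_m}, ~~ odd #|I| -> ~~ odd #|J| ->
      rank (F I `&` F J) + sdist I J = n) ->
  exists F', [/\ forall I : {set 'I_m}, ~~ odd #|I| -> generator Pi n (F' I),
    forall I J : {set 'I_m}, ~~ odd #|I| -> ~~ odd #|J| ->
      rank (F' I `&` F' J) + sdist I J = n,
    star F' &
    [set F' I | I in [set I : {set 'I_m} | ~~ odd #|I|]] =
    [set F I | I in [set I : {set 'I_m} | ~~ odd #|I|]]].
Proof.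
move=> em m4 F_generator F_rank.
have [st|Nst] := pselect (star F); first by exists F.
have m_eq : m = 4.
  have [m6|m6] := leqP 6 m; first by have := star6 PiP Pin em m4 F_generator F_rank m6.
  by move: em m4 m6; clear; case: m => [|[|[|[|[|[|k]]]]]].
have ev (I : {set 'I_m}) : ~~ odd #|I| -> ~~ odd #|pair_swap I| by rewrite card_pair_swap.
have tri := triangles_concurrent PiP Pin em m4 F_generator F_rank m_eq Nst.
exists (F \o (@pair_swap m)); split=> /=.
- by move=> I /ev /F_generator.
- by move=> I J eI eJ; rewrite -sdist_pair_swap //; apply: F_rank; exact: ev.
- move=> i j l a uq; have [ij il ia [jl ja la]] := uniq4 uq.
  have WE x y z w : uniq [:: x; y; z; w] ->
      trace (F \o @pair_swap m) [set x; y]%SET = trace F [set z; w]%SET.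
    move=> u; have [xy _ _ _] := uniq4 u.
    rewrite /trace /= /pair_swap (card_pair xy) eqxx (compl_pair m_eq u).
    by rewrite cardsT4.
  rewrite /concurrent (@WE i j l a) // (@WE i l j a); last first.
    by apply: uniq4I => //; rewrite eq_sym.
  rewrite (@WE i a j l); last by apply: uniq4I => //; rewrite eq_sym.
  rewrite (pairC l a) (pairC j a) setIC; apply: (tri a j l i).
  by apply: uniq4I => //; rewrite eq_sym.
- apply/seteqP; split=> _ [I eI <-].
    by exists (pair_swap I) => //; exact: ev.
  by exists (pair_swap I); [exact: ev|rewrite /= pair_swapK].
Qed.

Lemma half_cube_image (Gs : bool -> set (set T))
    (GsP : parity_split (dual_polar_graph Pi n) Gs) (delta : bool) (m : nat)
    (em : ~~ odd m) (m4 : 4 <= m)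
    (C : bool -> set (m.-tuple bool)) (CP : parity_split (hypercube m) C) (b : bool)
    (f : m.-tuple bool -> set T) :
    isometric_embedding (half_cube m (C b)) (half_spin_graph Pi n (Gs delta)) f ->
  exists M (R : bool -> 'I_m -> set T), [/\ sing M, rank M + m = n, cross_frame Pi M R &
    f @` C b = [set V | [/\ Gs delta V, M `<=` V &
                           forall i, exists c, R c i `<=` V]]].
Proof.
move=> fP; have [x Cx] : exists x, C b x by apply: half_nonempty => //; exact: leq_trans m4.
have [fG fR fI] := isometry_rank PiP Pin GsP CP fP Cx.
have [F [F_generator F_rank st FI]] := star_exists em m4 (fun I eI => Gs_generator PiP Pin GsP (fG I eI)) fR.
have {fR} GF (I : {set 'I_m}) : ~~ odd #|I| -> Gs delta (F I).
  move=> eI; have : [set F I | I in [set I : {set 'I_m} | ~~ odd #|I|]] (F I) by exists I.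
  by rewrite FI => -[J eJ <-]; exact: fG.
rewrite {}fI -{}FI.
exists (F finset.set0 `&` F [set: 'I_m]%SET), (cross Pi F); split.
- by apply: singII; [case: (F_generator _ (even0 m))|case: (F_generator _ (evenT em))].
- by have := F_rank _ _ (even0 m) (evenT em); rewrite sdist0 cardsT card_ord.
- exact: (cross_frameP PiP Pin em m4 F_generator F_rank st).
- exact: (cross_image PiP Pin em m4 F_generator F_rank st GsP GF).
Qed.

End HalfCubeImage.

(** * Residues and apartments *)

Definition cross_points T m (R : bool -> 'I_m -> T) : set T :=
  [set x | exists c i, R c i = x].

Lemma frame_cross_points T (G : geometry T) m (R : bool -> 'I_m -> T) :
    (forall c i, points G (R c i)) ->
    (forall c d i j, collinear G (R c i) (R d j) <-> (c == d) || (i != j)) ->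
  frame G m (cross_points R).
Proof.
move=> Rpt Rcol.
have E : 2 * m = #|{: bool * 'I_m}| by rewrite card_prod card_bool card_ord.
pose q (t : 'I_(2 * m)) : bool * 'I_m := enum_val (cast_ord E t).
pose q' (s : bool * 'I_m) : 'I_(2 * m) := cast_ord (esym E) (enum_rank s).
have q'K : cancel q' q by move=> s; rewrite /q /q' cast_ordKV enum_rankK.
have qK : cancel q q' by move=> t; rewrite /q /q' enum_valK cast_ordK.
have ncol s t : ~ collinear G (R s.1 s.2) (R t.1 t.2) <-> t = (~~ s.1, s.2).
  case: s t => [c i] [d j] /=; rewrite Rcol; split.
    move/negP; rewrite negb_or negbK => /andP[cd /eqP ->].
    by case: c d cd => [] [].
  by case=> -> ->; rewrite eqxx orbF; case: c.
exists (fun t => R (q t).1 (q t).2); split.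
- move=> s t st; apply: (can_inj qK).
  have /(ncol (q t) (~~ (q s).1, (q s).2)) :
      ~ collinear G (R (q t).1 (q t).2) (R (~~ (q s).1) (q s).2).
    by rewrite -st; apply/(ncol (q s) (~~ (q s).1, (q s).2)).
  by case: (q s) (q t) => [c i] [d j] /= [/negb_inj -> ->].
- apply/seteqP; split=> [_ [t _ <-]|_ [c [i <-]]]; first by exists (q t).1, (q t).2.
  by exists (q' (c, i)) => //; rewrite q'K.
- by move=> _ [c [i <-]].
- move=> t; exists (q' (~~ (q t).1, (q t).2)); split.
    by rewrite q'K; exact/ncol.
  by move=> s /ncol E'; rewrite -E' qK.
Qed.

Section Residue.
Variables (T : Type) (Pi : geometry T).
Hypothesis PiP : polar_space Pi.
Variable n : nat.
Hypothesis Pin : has_rank Pi n.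

Local Notation rank := (rank Pi).
Local Notation sing := (sing Pi).
Local Notation perpset := (perpset Pi).
Local Notation join := (join Pi).
Local Notation generator := (generator Pi n).

Variables (M : set T) (k : int).
Hypotheses (sM : sing M) (kE : k = ((rank M)%:Z - 1)%R).
Implicit Types (X Y Z D N U : set T).

Local Notation Res := (residue Pi M k).
Local Notation iv := (residue_interval Pi M (k + 1)%R).

Lemma residue_point X : points Res X <-> [/\ sing X, rank X = rank M + 1 & M `<=` X].
Proof.
split=> [[/(grassmannianP PiP Pin)[sX E] MX]|[sX E MX]]; first by split=> //; lia.
by split=> //; apply/(grassmannianP PiP Pin); split=> //; lia.
Qed.

Lemma residue_line L : lines Res L <->
  exists N, [/\ sing N, rank N = rank M + 2, M `<=` N & L = iv N].
Proof.
split=> [[N [/(grassmannianP PiP Pin)[sN E] MN] <-]|[N [sN E MN ->]]].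
  by exists N; split=> //; lia.
exists N => //; split=> //; apply/(grassmannianP PiP Pin); split=> //; lia.
Qed.

Lemma residue_meet X Y : points Res X -> sing Y -> M `<=` Y -> ~ X `<=` Y ->
  rank (X `&` Y) = rank M.
Proof.
move=> /residue_point[sX rX MX] sY MY XY; have sI := singII sX sY.
have lo : rank M <= rank (X `&` Y).
  by apply: (rank_sub PiP Pin) => // x Mx; split; [exact: MX|exact: MY].
apply/eqP; rewrite eqn_leq lo andbT leqNgt; apply/negP => gt; apply: XY.
have E : X `&` Y = X by apply: (rank_eq PiP Pin) => //; rewrite rX addn1.
by rewrite -E => x [].
Qed.

Lemma residue_sub_eq X Y : points Res X -> points Res Y -> X `<=` Y -> X = Y.
Proof.
move=> /residue_point[sX rX _] /residue_point[sY rY _] XY.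
by apply: (rank_eq PiP Pin) => //; rewrite rX rY.
Qed.

Lemma residue_join X Y : points Res X -> points Res Y -> X <> Y -> X `<=` perpset Y ->
  [/\ sing (join X Y), rank (join X Y) = rank M + 2 & M `<=` join X Y].
Proof.
move=> Xp Yp XY XYp.
have NXY : ~ X `<=` Y by move/(residue_sub_eq Xp Yp).
have [sX rX MX] := iffLR (residue_point X) Xp.
have [sY rY MY] := iffLR (residue_point Y) Yp.
have YXp : Y `<=` perpset X by apply: perpset_sym => //; exact: sing_sub.
split; [exact: sing_join| |by move=> x /MX; exact: joinl].
have := rank_joinI PiP Pin sX sY YXp; rewrite (residue_meet Xp sY MY NXY) rX rY.
by move: (rank _) => ?; lia.
Qed.

Lemma residue_join_eq X Y N : points Res X -> points Res Y -> X <> Y -> sing N ->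
  X `<=` N -> Y `<=` N -> rank N = rank M + 2 -> join X Y = N.
Proof.
move=> Xp Yp XY sN XN YN rN.
have [sJ rJ _] := residue_join Xp Yp XY (sub_perp sN XN YN).
apply: (rank_eq PiP Pin) => //; last by rewrite rN rJ.
by apply: join_min => //; case: sN.
Qed.

Lemma residue_collinear X Y : points Res X -> points Res Y -> X <> Y -> X `<=` perpset Y ->
  collinear Res X Y.
Proof.
move=> Xp Yp XY XYp; have [sJ rJ MJ] := residue_join Xp Yp XY XYp.
exists (iv (join X Y)); split; first by apply/residue_line; exists (join X Y).
- by split=> // x; exact: joinl.
- by split=> // x; exact: joinr.
Qed.

Lemma residue_collinear_perp X Y : collinear Res X Y -> X `<=` perpset Y.
Proof.
move=> [L [/residue_line[N [sN _ _ ->]] [_ XN] [_ YN]]]; exact: sub_perp sN XN YN.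
Qed.

Lemma interval_subspace U : sing U -> subspace Res (iv U).
Proof.
move=> sU; split=> [X []//|L X Y /residue_line[N [sN rN MN ->]]].
move=> [Xp XU] [Yp YU] XY [_ XN] [_ YN] Z [Zp ZN]; split=> //.
apply: subset_trans ZN _; rewrite -(residue_join_eq Xp Yp XY sN XN YN rN).
by apply: join_min => //; case: sU.
Qed.

Lemma interval_cover U u : sing U -> M `<=` U -> rank M < rank U -> U u ->
  exists2 Y, iv U Y & Y u.
Proof.
move=> sU MU lt.
have base v : U v -> ~ M v -> iv U (join M [set v]).
  move=> Uv Mv; have Mv' : perpset M v by apply: (sub_perp sU (@subset_refl _ U) MU).
  split.
    apply/residue_point; split; [exact: sing_add| |exact: joinl].
    by rewrite (rank_add PiP Pin) // addn1.
  by apply: join_min => //; [case: sU|move=> _ ->].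
move=> Uu; have [Mu|NMu] := pselect (M u); last first.
  by exists (join M [set u]); [exact: base|exact: joinr].
have [v [Uv NMv]] : exists v, U v /\ ~ M v.
  apply: contrapT => H; move: lt; rewrite ltnNge (rank_sub PiP Pin) // => v Uv.
  by apply: contrapT => NMv; apply: H; exists v.
by exists (join M [set v]); [exact: base|exact: joinl].
Qed.

Lemma interval_maximal U : generator U -> M `<=` U -> rank M < n -> maximal_singular Res (iv U).
Proof.
move=> mU MU lt; have sU := generator_sing mU; split.
  split; first exact: interval_subspace.
  move=> X Y [Xp XU] [Yp YU] XY; apply: residue_collinear => //.
  exact: sub_perp sU XU YU.
move=> V [[Vpt _] Vcol] UV; apply/seteqP; split=> // X VX; split; first exact: Vpt.
have [sX _ _] := iffLR (residue_point X) (Vpt _ VX).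
move=> x Xx; apply: (generator_perp PiP Pin mU); split; first exact: sing_sub sX _ Xx.
move=> u Uu; have [|Y [Yp YU] Yu] := interval_cover sU MU _ Uu; first by rewrite (proj2 mU).
have [YX|YX] := pselect (Y = X); first by apply: sing_col sX _ Xx; rewrite -YX.
have /residue_collinear_perp/(_ u Yu)[_ /(_ x Xx)] : collinear Res Y X.
  by apply: Vcol => //; exact: UV.
exact: col_sym.
Qed.

(** A point Y of the residue in the join of D and P is on the line through P and the
    trace on D of the join of Y and P. *)
Lemma interval_add V D P U : subspace Res V -> sing D -> M `<=` D -> sing U ->
    D `<=` U -> iv D `<=` V -> V P -> P `<=` U -> ~ P `<=` D -> iv (join D P) `<=` V.
Proof.
move=> [Vpt sV] sD MD sU DU DV VP PU PD Y [Yp YJ].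
have Pp := Vpt _ VP; have [sP rP MP] := iffLR (residue_point P) Pp.
have [YP|YP] := pselect (Y = P); first by rewrite YP.
have [sY _ _] := iffLR (residue_point Y) Yp.
have [sJ JU rJ] := rank_join_in PiP Pin sD sP sU DU PU.
have PJ : P `<=` join D P by exact: joinr.
have DJ : D `<=` join D P by exact: joinl.
have [sN rN MN] := residue_join Yp Pp YP (sub_perp sJ YJ PJ).
have NJ : join Y P `<=` join D P by apply: join_min => //; case: sJ.
have [sK KJ rK] := rank_join_in PiP Pin sN sD sJ NJ DJ.
pose Z := join Y P `&` D; have sZ : sing Z by exact: singII.
have rDP : rank (D `&` P) = rank M by rewrite setIC; exact: residue_meet.
have lo : rank M + 1 <= rank Z.
  have := rank_sub PiP Pin sK sJ KJ; move: rJ rK rP rN rDP; rewrite -/Z; rank_lia.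
have hi : rank Z <= rank M + 1.
  rewrite leqNgt; apply/negP => gt; apply: PD.
  have E : Z = join Y P by apply: (rank_eq PiP Pin) => //; [exact: subIsetl|rewrite rN; lia].
  move=> x Px; have : Z x by rewrite E; exact: joinr.
  by case.
have Zp : points Res Z.
  apply/residue_point; split=> //; first by apply/eqP; rewrite eqn_leq hi lo.
  by move=> x Mx; split; [exact: MN|exact: MD].
have VZ : V Z by apply: DV; split=> // x [].
have ZP : Z <> P by move=> ZP; apply: PD; rewrite -ZP => x [].
have lN : lines Res (iv (join Y P)) by apply/residue_line; exists (join Y P).
apply: (sV _ Z P lN VZ VP ZP).
- by split=> // x [].
- by split=> // x; exact: joinr.
- by split=> // x; exact: joinl.
Qed.

Variables (m : nat) (R : bool -> 'I_m -> set T).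
Hypotheses (m2 : 2 <= m) (Mm : rank M + m = n) (RP : cross_frame Pi M R).

Lemma cross_point c i : points Res (R c i).
Proof.
apply/residue_point.
by split; [exact: (cross_sing RP)|exact: (cross_rank RP)|exact: (cross_sub RP)].
Qed.

Lemma cross_not_perp c i : ~ R c i `<=` perpset (R (~~ c) i).
Proof.
have [x [y [Rx Ry yx]]] := cross_opposite c i RP.
by move=> /(_ x Rx)[_ /(_ y Ry)].
Qed.

Lemma cross_collinear c d i j : collinear Res (R c i) (R d j) <-> (c == d) || (i != j).
Proof.
split=> [/residue_collinear_perp cp|cdij].
  apply: contraPT cp; rewrite negb_or negbK => /andP[cd /eqP ->].
  have -> : d = ~~ c by case: c d cd => [] [].
  exact: cross_not_perp.
have neq c' i' j' d' : i' != j' -> R c' i' <> R d' j'.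
  move=> ij E; apply: (@cross_not_perp c' i'); rewrite E.
  by apply: (cross_perp RP); apply/orP; right; rewrite eq_sym.
have [E|NE] := pselect (R c i = R d j); last first.
  apply: residue_collinear => //; [exact: cross_point|exact: cross_point|].
  exact: (cross_perp RP cdij).
rewrite -E; have [j' j'i] : exists j', j' != i.
  have [|j'] := @notin_ex m [:: i]; first exact: m2.
  by rewrite inE => ?; exists j'.
have : collinear Res (R c i) (R c j').
  apply: residue_collinear; [exact: cross_point|exact: cross_point| |].
    by apply: neq; rewrite eq_sym.
  by apply: (cross_perp RP); rewrite eqxx.
by case=> L [? ? _]; exists L.
Qed.

(** A subspace of the residue that contains the chosen frame points grows by
    [interval_add] until every one of them has been used; the result then has rank
    n by independence. *)
Lemma span_cross U : generator U -> M `<=` U -> (forall i, exists c, R c i `<=` U) ->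
  iv U = subspace_span Res [set Y | cross_points R Y /\ Y `<=` U].
Proof.
move=> mU MU RU; have sU := generator_sing mU; apply/seteqP; split; last first.
  apply: span_min; first exact: interval_subspace.
  by move=> Y [[c [i <-]] YU]; split=> //; exact: cross_point.
move=> Y UY V [sV RV]; move: Y UY.
have [c RcU] := choice RU.
suff H q D : sing D -> M `<=` D -> D `<=` U -> iv D `<=` V -> n - rank D <= q -> iv U `<=` V.
  apply: (H n M) => //; last exact: leq_subr.
  move=> Y [/residue_point[sY rY _] YM].
  by have := rank_sub PiP Pin sY sM YM; rewrite rY addn1 ltnn.
elim: q D => [|q IH] D sD MD DU DV le.
  suff <- : D = U by [].
  by apply: (rank_eq PiP Pin) => //; rewrite (proj2 mU); lia.
have [[i NRi]|RD] := pselect (exists i, ~ R (c i) i `<=` D); last first.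
  suff <- : D = U by [].
  apply: (rank_eq PiP Pin) => //.
  rewrite (proj2 mU) -Mm -[X in _ + X](card_ord m) -cardsT.
  apply: (cross_frame_rank PiP Pin (c := c) RP sM) => // i _.
  by apply: contrapT => NRi; apply: RD; exists i.
have VR : V (R (c i) i) by apply: RV; split; [exists (c i), i|exact: RcU].
have [sJ JU rJ] := rank_join_in PiP Pin sD (cross_sing RP (c i) i) sU DU (RcU i).
apply: (IH (join D (R (c i) i))) => //.
- by move=> x /MD; exact: joinl.
- exact: interval_add sV sD MD sU DU DV VR (RcU i) NRi.
- have rI : rank (D `&` R (c i) i) = rank M.
    by rewrite setIC; apply: residue_meet => //; exact: cross_point.
  by move: le rJ; rewrite rI (cross_rank RP); rank_lia.
Qed.

(** If neither frame point of index i were below U, all spanning frame points would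
    be perpendicular to R true i, hence so would U, and R true i would be in U. *)
Lemma apartment_cross U : generator U -> M `<=` U ->
  apartment Res (cross_points R) (iv U) <-> forall i, exists c, R c i `<=` U.
Proof.
move=> mU MU; have sU := generator_sing mU; have lt : rank M < n by rewrite -Mm; lia.
split=> [[_ [X XF UX]] i|RU]; last first.
  split; first exact: interval_maximal.
  by exists [set Y | cross_points R Y /\ Y `<=` U]; [move=> Y []|exact: span_cross].
apply: contrapT => /forallNP NR.
have XU Y : X Y -> Y `<=` U by move=> /(@subset_span _ Res); rewrite -UX => -[].
pose V := [set Y | points Res Y /\ Y `<=` perpset (R true i)].
have sV : subspace Res V.
  split=> [Y []//|L Y Y' /residue_line[N [sN rN MN ->]]].
  move=> [Yp YR] [Y'p Y'R] YY' [_ YN] [_ Y'N] Z [Zp ZN]; split=> //.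
  apply: subset_trans ZN _; rewrite -(residue_join_eq Yp Y'p YY' sN YN Y'N rN).
  by apply: join_min => //; exact: perpset_subspace.
have XV : X `<=` V.
  move=> Y XY; have [c [j Yj]] := XF _ XY; rewrite -Yj; split; first exact: cross_point.
  apply: (cross_perp RP); apply/orP; right; apply/eqP => ji; apply: (NR c).
  by rewrite -ji Yj; exact: XU.
have UV : iv U `<=` V by rewrite UX; exact: span_min.
apply: (NR true) => x Rx; apply: (generator_perp PiP Pin mU).
split; first exact: sing_sub (cross_sing RP _ _) _ Rx.
move=> u Uu; have [|Y UY Yu] := interval_cover sU MU _ Uu; first by rewrite (proj2 mU).
by have [_ /(_ u Yu)[_ /(_ x Rx)]] := UV _ UY; exact: col_sym.
Qed.

End Residue.

Section FullCross.
Variables (T : Type) (Pi : geometry T).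
Hypothesis PiP : polar_space Pi.
Variable n : nat.
Hypothesis Pin : has_rank Pi n.
Variable p : bool -> 'I_n -> T.
Hypothesis pP : cross_frame Pi set0 (fun c i => [set p c i]).

Lemma full_cross_point c i : points Pi (p c i).
Proof. exact: (sing_sub (cross_sing pP c i) (erefl (p c i))). Qed.

Lemma full_cross_collinear c d i j :
  collinear Pi (p c i) (p d j) <-> (c == d) || (i != j).
Proof.
split=> [cp|/(cross_perp pP)/(_ _ erefl)/(perpset1 PiP)]; last exact: col_sym.
apply: contraPT cp; rewrite negb_or negbK => /andP[cd /eqP ->] pp.
have [_ [_ [-> -> []]]] := cross_opposite c j pP.
have <- : d = ~~ c by case: c d cd {pp} => [] [].
exact: col_sym.
Qed.

(** The same argument as for residues, in the space itself. *)
Lemma apartment_full_cross U : generator Pi n U ->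
  apartment Pi (cross_points p) U <-> forall i, exists c, U (p c i).
Proof.
move=> mU; have sU := generator_sing mU.
split=> [[_ [X XF UX]] i|RU]; last first.
  split; first exact/(generator_maximal PiP Pin).
  have [c Uc] := choice RU.
  pose X := cross_points p `&` U; exists X; first by move=> x [].
  have XU : subspace_span Pi X `<=` U by apply: span_min; [case: sU|move=> x []].
  have Xpt : X `<=` points Pi by move=> x [_ /(sing_sub sU)].
  have sX : sing Pi (subspace_span Pi X) by exact: sing_subset sU (span_subspace PiP Xpt) XU.
  apply/esym/(rank_eq PiP Pin) => //; rewrite (proj2 mU).
  have : rank Pi set0 + #|[set: 'I_n]%SET| <= rank Pi (subspace_span Pi X).
    apply: (cross_frame_rank PiP Pin (c := c) pP (sing0 Pi)) => // i _ _ ->.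
    by apply: subset_span; split; [exists (c i), i|].
  by rewrite (rank0 PiP Pin) cardsT card_ord.
apply: contrapT => /forallNP NR.
have XU : X `<=` U by rewrite UX; exact: subset_span.
have : U `<=` perpset Pi [set p true i].
  rewrite UX; apply: span_min; first exact: perpset_subspace.
  move=> x Xx; have [c [j xj]] := XF _ Xx; apply/(perpset1 PiP); rewrite -xj.
  apply/full_cross_collinear; apply/orP; right; apply/eqP => ij; apply: (NR c).
  by rewrite ij xj; exact: XU.
move=> Up; apply: (NR true); apply: (generator_perp PiP Pin mU).
split; first exact: full_cross_point.
by move=> u /Up /(perpset1 PiP); exact: col_sym.
Qed.

End FullCross.

Theorem theorem3p2 (T : Type) (Pi : geometry T) (n : nat)
    (PiD : typeD Pi n)
    (Gs : bool -> set (set T))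
    (GsP : parity_split (dual_polar_graph Pi n) Gs)
    (delta : bool)
    (m : nat) (m_even : ~~ odd m) (m_bounds : 4 <= m <= n) :
  (forall (C : bool -> set (m.-tuple bool)),
     parity_split (hypercube m) C ->
     forall (b : bool) (f : m.-tuple bool -> set T),
     isometric_embedding (half_cube m (C b))
                         (half_spin_graph Pi n (Gs delta)) f ->
     exists2 M, grassmannian Pi (n%:Z - m%:Z - 1)%R M &
       is_residue_half_apartment Pi m (Gs delta) M (n%:Z - m%:Z - 1)%R
         (f @` C b))
  /\
  (~~ odd n ->
   forall (C : bool -> set (n.-tuple bool)),
     parity_split (hypercube n) C ->
     forall (b : bool) (f : n.-tuple bool -> set T),
     isometric_embedding (half_cube n (C b))
                         (half_spin_graph Pi n (Gs delta)) f ->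
     is_half_apartment Pi n (Gs delta) (f @` C b)).
Proof.
have [PiP Pin _] := PiD; have /andP[m4 mn] := m_bounds.
split=> [C CP b f fP|n_even C CP b f fP].
  have [M [R [sM Mm RP ->]]] := half_cube_image PiP Pin GsP m_even m4 CP fP.
  have kE : (n%:Z - m%:Z - 1 = (rank Pi M)%:Z - 1)%R by lia.
  have m2 : 2 <= m by exact: leq_trans m4.
  exists M; first exact/(grassmannianP PiP Pin).
  pose iv := residue_interval Pi M (n%:Z - m%:Z - 1 + 1)%R.
  exists (apartment (residue Pi M (n%:Z - m%:Z - 1)%R) (cross_points R) `&`
          iv @` above_half (Gs delta) M).
    exists (cross_points R) => //.
    apply: frame_cross_points => [c i|c d i j].
      exact: (cross_point PiP Pin kE RP).
    exact: (cross_collinear PiP Pin sM kE m2 RP).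
  apply/seteqP; split=> [U [GU MU RU]|U [[GU MU] [aU _]]].
    split; first by [].
    split; last by exists U.
    exact/(apartment_cross PiP Pin sM kE m2 Mm RP (Gs_generator PiP Pin GsP GU) MU).
  split=> //.
  exact/(apartment_cross PiP Pin sM kE m2 Mm RP (Gs_generator PiP Pin GsP GU) MU).
have n4 : 4 <= n by exact: leq_trans mn.
have [M [R [sM Mm RP ->]]] := half_cube_image PiP Pin GsP n_even n4 CP fP.
have M0 : set0 = M.
  by apply: (rank_eq PiP Pin sM (sing0 Pi)) => //; rewrite (rank0 PiP Pin); lia.
have Rpt c i : exists p, R c i = [set p].
  apply: (rank_eq1 PiP Pin); first exact: (cross_sing RP).
  by rewrite (cross_rank RP) -M0 (rank0 PiP Pin).
have [q qE] := choice (fun ci : bool * 'I_n => Rpt ci.1 ci.2).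
pose p c i := q (c, i).
have RE : R = fun c i => [set p c i].
  by apply/funext => c; apply/funext => i; exact: (qE (c, i)).
rewrite RE -M0 in RP *.
exists (cross_points p).
  apply: frame_cross_points => [c i|c d i j]; first exact: (full_cross_point RP).
  exact: (full_cross_collinear PiP RP).
apply/seteqP; split=> [U [GU _ RU]|U [aU GU]].
  split=> //; apply/(apartment_full_cross PiP Pin RP (Gs_generator PiP Pin GsP GU)) => i.
  by have [c /(_ _ erefl)] := RU i; exists c.
split=> //.
move=> i; have [c Uc] := iffLR (apartment_full_cross PiP Pin RP (Gs_generator PiP Pin GsP GU)) aU i.
by exists c => _ ->.
Qed.
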